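(* Let $A$ be a gendo-symmetric algebra and $M$ an $A$-module. Then $M$ is Gorenstein-projective-injective if and only if $M$ has infinite dominant dimension and infinite codominant dimension.
   Context: Algebras are finite dimensional, connected and non-semisimple over a field $K$ (and may be assumed basic); modules are finite dimensional right modules. $D=\operatorname{Hom}_K(-,K)$. An algebra $B$ is symmetric if $B\cong D(B)$ as $B$-bimodules. An algebra $A$ is gendo-symmetric if $A \cong \operatorname{End}_B(N)$ for a symmetric algebra $B$ and a generator $N$ of $\operatorname{mod-}B$. The dominant dimension of a module $M$ with minimal injective coresolution $0 \to M \to I_0 \to I_1 \to \cdots$ is the smallest $n\ge 0$ such that $I_n$ is not projective, and is infinite if no such $n$ exists. The codominant dimension of $M$ is the dominant dimension of $D(M)$; equivalently, for a minimal projective resolution $\cdots \to P_1\to P_0\to M\to 0$, the smallest $n$ such that $P_n$ is not injective (infinite if none exists). A module $M$ is Gorenstein-projective if $\operatorname{Ext}_A^i(M,A)=0=\operatorname{Ext}_A^i(\operatorname{Tr}(M),A)$ for all $i\ge1$, where $\operatorname{Tr}$ is the Auslander-Bridger transpose; $M$ is Gorenstein-injective if $D(M)$ is Gorenstein-projective; $M$ is Gorenstein-projective-injective if it is both. *)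

(* Defs.v *)
(* MathComp world. *)
From HB Require Import structures.
From mathcomp Require Import all_boot all_order all_algebra all_field.

Set Implicit Arguments.
Unset Strict Implicit.
Unset Printing Implicit Defensive.

Import GRing.Theory.
Local Open Scope ring_scope.

(* The opposite algebra: MathComp only equips the converse ring A^c with its
   ring structure, so the K-algebra structure is added here. *)
Section Opposite.
Variables (K : fieldType) (A : falgType K).

HB.instance Definition _ := Vector.on A^c.

HB.instance Definition _ := GRing.Lmodule_isLalgebra.Build K A^c
  (fun (k : K) (u v : A) => scalerAr k v u).

HB.instance Definition _ := GRing.Lalgebra_isAlgebra.Build K A^c
  (fun (k : K) (u v : A) => scalerAl k v u).

(* A^c is convertible to A, so the two products are told apart only by the
   structure; this checks that the one of the falgType A^c is reversed. *)
Fact converse_mulE (u v : (A^c : falgType K)) :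
  u * v = (v : A) * (u : A) :> A.
Proof. by []. Qed.

End Opposite.

(* Finite dimensional right A-modules; left A-modules are right modules over
   A^c. *)
Record rmodule (K : fieldType) (A : falgType K) := RModule {
  rmod_vect :> vectType K;
  ract : rmod_vect -> A -> rmod_vect;
  ract_linl : forall a, linear (fun x => ract x a);
  ract_linr : forall x, linear (ract x);
  ract1 : forall x, ract x 1 = x;
  ractM : forall x a b, ract x (a * b) = ract (ract x a) b
}.

Section Modules.
Variables (K : fieldType) (A : falgType K).
Implicit Types M N P : rmodule A.

Definition is_submod M (U : {vspace M}) : Prop :=
  forall x a, x \in U -> ract x a \in U.

Definition semisimple M : Prop :=
  forall U : {vspace M}, is_submod U ->
  exists W : {vspace M},
    [/\ is_submod W, (U + W = fullv)%VS & (U :&: W = 0)%VS].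

Definition essential M (U : {vspace M}) : Prop :=
  forall W : {vspace M}, is_submod W -> (W :&: U = 0)%VS -> (W = 0)%VS.

Definition ract_end M (a : A) : 'End(M) := linfun (fun x => ract x a).

Fact ract_endE M a (x : M) : ract_end M a x = ract x a.
Proof.
pose h := GRing.isSemilinear.Build K M M _ (fun x => ract x a)
  (GRing.semilinear_linear (ract_linl (r := M) a)).
pose f : {linear M -> M} := HB.pack (fun x => ract x a) h.
exact: (lfunE f x).
Qed.

Fact ract_end_is_linear M : linear (@ract_end M).
Proof.
move=> k a b; apply/lfunP => x.
by rewrite add_lfunE scale_lfunE !ract_endE ract_linr.
Qed.

Definition commutator M N (a : A) (f : 'Hom(M, N)) : 'Hom(M, N) :=
  ((f \o ract_end M a) - (ract_end N a \o f))%VF.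

Fact commutator_is_linear M N a : linear (@commutator M N a).
Proof.
move=> k f g; apply/lfunP=> x; rewrite /commutator.
rewrite !(add_lfunE, opp_lfunE, scale_lfunE, comp_lfunE) linearP.
by rewrite scalerBr opprD addrACA.
Qed.

HB.instance Definition _ M N a :=
  GRing.isSemilinear.Build K 'Hom(M, N) 'Hom(M, N) _ (@commutator M N a)
    (GRing.semilinear_linear (@commutator_is_linear M N a)).

(* Hom_A(M, N) as a subspace of the K-linear maps; commuting with a K-basis
   of A suffices, see HomAP. *)
Definition HomA M N : {vspace 'Hom(M, N)} :=
  (\bigcap_(i < \dim {:A}) lker (linfun (commutator (vbasis {:A})`_i)))%VS.

Lemma HomAP M N (f : 'Hom(M, N)) :
  reflect (forall x a, f (ract x a) = ract (f x) a) (f \in HomA M N).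
Proof.
apply: (iffP idP) => [fH x a | fH].
  have fb (i : 'I_(\dim {:A})) :
      f (ract x (vbasis {:A})`_i) = ract (f x) (vbasis {:A})`_i.
    move: fH; rewrite memvE => /subv_bigcapP/(_ i isT); rewrite -memvE.
    rewrite memv_ker lfunE /= => /eqP/lfunP/(_ x).
    rewrite /commutator !(add_lfunE, opp_lfunE, comp_lfunE, zero_lfunE) !ract_endE.
    by move/eqP; rewrite subr_eq0 => /eqP.
  rewrite (coord_vbasis (memvf a)) -ract_endE -[RHS]ract_endE.
  have sumE (Q : rmodule A) (y : Q) (c : 'I_(\dim {:A}) -> K) :
      ract_end Q (\sum_i c i *: (vbasis {:A})`_i) y
        = \sum_i c i *: ract y (vbasis {:A})`_i.
    rewrite ract_endE.
    pose h := GRing.isSemilinear.Build K A Q _ (ract y)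
      (GRing.semilinear_linear (ract_linr y)).
    pose g : {linear A -> Q} := HB.pack (ract y) h.
    rewrite -[ract y]/(g : A -> Q) linear_sum.
    by apply: eq_bigr => i _; rewrite linearZ.
  rewrite !sumE linear_sum; apply: eq_bigr => i _.
  by rewrite linearZ /= fb.
rewrite memvE; apply/subv_bigcapP => i _; rewrite -memvE memv_ker lfunE /=.
apply/eqP/lfunP => x.
rewrite /commutator !(add_lfunE, opp_lfunE, comp_lfunE, zero_lfunE) !ract_endE.
by rewrite fH subrr.
Qed.

Definition is_projective P : Prop :=
  forall M N (g : 'Hom(M, N)) (f : 'Hom(P, N)),
    g \in HomA M N -> limg g = fullv -> f \in HomA P N ->
  exists2 h, h \in HomA P M & f = (g \o h)%VF.

Definition is_injective P : Prop :=
  forall M N (g : 'Hom(M, N)) (f : 'Hom(M, P)),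
    g \in HomA M N -> (lker g = 0)%VS -> f \in HomA M P ->
  exists2 h, h \in HomA N P & f = (h \o g)%VF.

Definition regmod : rmodule A.
Proof.
refine (@RModule K A A (fun x a => x * a) _ _ _ _).
- by move=> a k x y; rewrite mulrDl scalerAl.
- by move=> x k a b; rewrite mulrDr scalerAr.
- exact: mulr1.
- exact: mulrA.
Defined.

Definition powmod N (n : nat) : rmodule A.
Proof.
refine (@RModule K A {ffun 'I_n -> N}
  (fun (x : {ffun 'I_n -> N}) a => [ffun i => ract (x i) a]) _ _ _ _).
- by move=> a k x y; apply/ffunP=> i; rewrite !ffunE ract_linl.
- by move=> x k a b; apply/ffunP=> i; rewrite !ffunE ract_linr.
- by move=> x; apply/ffunP=> i; rewrite !ffunE ract1.
- by move=> x a b; apply/ffunP=> i; rewrite !ffunE ractM.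
Defined.

Definition generator N : Prop :=
  forall M, exists n, exists2 f, f \in HomA (powmod N n) M & limg f = fullv.

(* D(M) = Hom_K(M, K), with (f . a)(x) = f (x . a). *)
Definition dualmod M : rmodule A^c.
Proof.
refine (@RModule K A^c 'Hom(M, K^o)
  (fun f a => (f \o ract_end M a)%VF) _ _ _ _).
- by move=> a k f g; rewrite comp_lfunDl comp_lfunZl.
- move=> f k a b; apply/lfunP=> x.
  by rewrite add_lfunE scale_lfunE !comp_lfunE !ract_endE ract_linr linearP.
- by move=> f; apply/lfunP=> x; rewrite comp_lfunE ract_endE ract1.
- move=> f a b; apply/lfunP=> x.
  by rewrite !comp_lfunE !ract_endE -ractM.
Defined.

Fact star_act_subproof P (f : subvs_of (HomA P regmod)) (a : A) :
  (amull a \o vsval f)%VF \in HomA P regmod.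
Proof.
apply/HomAP => x b; rewrite !comp_lfunE.
by rewrite (HomAP _ (subvsP f)) !lfunE /= mulrA.
Qed.

(* Hom_A(P, A) as a left A-module, with (a . f)(x) = a * f x. *)
Definition starmod P : rmodule A^c.
Proof.
refine (@RModule K A^c (subvs_of (HomA P regmod))
  (fun f a => Subvs (star_act_subproof f a)) _ _ _ _).
- move=> a k f g; apply: val_inj => /=.
  by rewrite comp_lfunDr comp_lfunZr.
- move=> f k a b; apply: val_inj => /=.
  by rewrite linearP comp_lfunDl comp_lfunZl.
- by move=> f; apply: val_inj; rewrite /= amull1 comp_lfun1l.
- move=> f a b; apply: val_inj; apply/lfunP => x /=.
  by rewrite !comp_lfunE !lfunE /= mulrA.
Defined.

Record proj_resolution M := ProjResolution {
  pres_obj :> nat -> rmodule A;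
  pres_d : forall n, 'Hom(pres_obj n.+1, pres_obj n);
  pres_aug : 'Hom(pres_obj 0, M);
  pres_proj : forall n, is_projective (pres_obj n);
  pres_d_hom : forall n, pres_d n \in HomA (pres_obj n.+1) (pres_obj n);
  pres_aug_hom : pres_aug \in HomA (pres_obj 0) M;
  pres_aug_surj : limg pres_aug = fullv;
  pres_exact0 : limg (pres_d 0) = lker pres_aug;
  pres_exact : forall n, limg (pres_d n.+1) = lker (pres_d n)
}.

Record min_inj_coresolution M := MinInjCoresolution {
  ires_obj :> nat -> rmodule A;
  ires_d : forall n, 'Hom(ires_obj n, ires_obj n.+1);
  ires_aug : 'Hom(M, ires_obj 0);
  ires_inj : forall n, is_injective (ires_obj n);
  ires_d_hom : forall n, ires_d n \in HomA (ires_obj n) (ires_obj n.+1);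
  ires_aug_hom : ires_aug \in HomA M (ires_obj 0);
  ires_aug_inj : (lker ires_aug = 0)%VS;
  ires_exact0 : limg ires_aug = lker (ires_d 0);
  ires_exact : forall n, limg (ires_d n) = lker (ires_d n.+1);
  ires_min0 : essential (limg ires_aug);
  ires_min : forall n, essential (limg (ires_d n))
}.

(* domdim M d : the dominant dimension of M is d, where None stands for
   infinity.  Minimal injective coresolutions are unique up to isomorphism. *)
Definition domdim M (d : option nat) : Prop :=
  exists I : min_inj_coresolution M,
    if d is Some n
    then ~ is_projective (I n) /\ (forall m, (m < n)%N -> is_projective (I m))
    else forall n, is_projective (I n).

Definition precomp (P Q N : rmodule A) (d : 'Hom(P, Q)) (f : 'Hom(Q, N)) :
    'Hom(P, N) := (f \o d)%VF.

Fact precomp_is_linear (P Q N : rmodule A) (d : 'Hom(P, Q)) :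
  linear (@precomp P Q N d).
Proof. by move=> k f g; rewrite /precomp comp_lfunDl comp_lfunZl. Qed.

HB.instance Definition _ (P Q N : rmodule A) (d : 'Hom(P, Q)) :=
  GRing.isSemilinear.Build K 'Hom(Q, N) 'Hom(P, N) _ (@precomp P Q N d)
    (GRing.semilinear_linear (@precomp_is_linear P Q N d)).

Definition cocycles M (P : proj_resolution M) N n : {vspace 'Hom(P n, N)} :=
  (HomA (P n) N :&: lker (linfun (precomp (pres_d P n))))%VS.

Definition coboundaries M (P : proj_resolution M) N n :
    {vspace 'Hom(P n, N)} :=
  match n with
  | 0 => 0%VS
  | m.+1 => (linfun (precomp (pres_d P m)) @: HomA (P m) N)%VS
  end.

(* Ext^n_A(M, N) = 0, where Ext^n_A(M, N) is the n-th cohomology of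
   Hom_A(P, N); up to isomorphism it does not depend on P. *)
Definition Ext_eq0 n M N : Prop :=
  exists P : proj_resolution M, cocycles P N n = coboundaries P N n.

End Modules.

Arguments regmod {K} A.

(* T is a transpose of M: for a projective presentation
   P1 --q--> P0 --p--> M --> 0, T is the cokernel of
   Hom_A(q, A) : Hom_A(P0, A) -> Hom_A(P1, A).  As the presentation is not
   required to be minimal, T is unique up to projective direct summands. *)
Definition is_transpose (K : fieldType) (A : falgType K) (M : rmodule A)
    (T : rmodule A^c) : Prop :=
  exists (P0 P1 : rmodule A) (p : 'Hom(P0, M)) (q : 'Hom(P1, P0))
         (pi : 'Hom(starmod P1, T)),
    [/\ [/\ is_projective P0, is_projective P1,
            p \in HomA P0 M & q \in HomA P1 P0],
        limg p = fullv & limg q = lker p] /\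
    [/\ pi \in HomA (starmod P1) T, limg pi = fullv &
        forall f : starmod P1,
          pi f = 0 <-> exists g : starmod P0, vsval f = precomp q (vsval g)].

Definition codomdim (K : fieldType) (A : falgType K)
    (M : rmodule A) (d : option nat) : Prop := domdim (dualmod M) d.

Definition Gorenstein_projective (K : fieldType) (A : falgType K)
    (M : rmodule A) : Prop :=
  exists2 T : rmodule A^c, is_transpose M T &
    forall i, (1 <= i)%N ->
      Ext_eq0 i M (regmod A) /\ Ext_eq0 i T (regmod A^c).

Definition Gorenstein_injective (K : fieldType) (A : falgType K)
    (M : rmodule A) : Prop := Gorenstein_projective (dualmod M).

Definition Gorenstein_projective_injective (K : fieldType) (A : falgType K)
    (M : rmodule A) : Prop :=
  Gorenstein_projective M /\ Gorenstein_injective M.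

(* Not a direct product; an falgType is never the zero algebra. *)
Definition connected (K : fieldType) (A : falgType K) : Prop :=
  forall (A1 A2 : falgType K) (f : {lrmorphism A -> (A1 * A2)%type}),
    ~ bijective f.

Definition standing (K : fieldType) (A : falgType K) : Prop :=
  connected A /\ ~ semisimple (regmod A).

(* B is isomorphic to D(B), where (a . f . b)(y) = f (b * y * a). *)
Definition symmetric_algebra (K : fieldType) (B : falgType K) : Prop :=
  exists2 phi : 'Hom(B, 'Hom(B, K^o)), bijective phi &
    forall a x b y, phi (a * x * b) y = phi x (b * y * a).

(* Endomorphisms act on the left of right modules, so the product of
   End_B(N) is the composition of maps. *)
Definition iso_End (K : fieldType) (A B : falgType K) (N : rmodule B) :
    Prop :=
  exists phi : 'Hom(A, 'End(N)),
    [/\ (lker phi = 0)%VS, limg phi = HomA N N, phi 1 = \1%VF &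
        forall a b, phi (a * b) = (phi a \o phi b)%VF].

Definition gendo_symmetric (K : fieldType) (A : falgType K) : Prop :=
  exists (B : falgType K) (N : rmodule B),
    [/\ standing B, symmetric_algebra B, generator N & iso_End A N].

(* Main.v *)
Require Import Defs.
From HB Require Import structures.
From mathcomp Require Import all_boot all_order all_algebra all_field.
From Stdlib Require Import ClassicalEpsilon.
Set Implicit Arguments.
Unset Strict Implicit.
Unset Printing Implicit Defensive.
Import GRing.Theory.
Local Open Scope ring_scope.

(** Write D for Hom_K(-, K).  What is used of a gendo-symmetric algebra A is
    ([dualizing_data]) that A embeds in a projective-injective right module and
    that there is a bimodule map c : D(A) -> A, symmetric in the sense that
    f(c(g)) = g(c(f)), for which a |-> a c(-) identifies A with Hom_A(D(A), A).
    If A = End_B(N), the symmetrizing form of B identifies D(A) with the tensor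
    product over B of N and Hom_B(N, B), and c sends the tensor of n and p to the
    endomorphism m |-> n p(m) ([gendo_symmetric_dualizing_data]).  These data
    pass to the opposite algebra ([dualizing_data_op]), so that each of the two
    arguments below has to be made for one property of M only.

    By means of c, the Nakayama functor D Hom_A(-, A) is the identity on injective
    modules ([injective_nakayama]), and the inverse Nakayama functor
    Hom_A(D(A), -) is the identity on reflexive ones ([reflexive_conakayama]).

    Suppose that M has infinite dominant and codominant dimension.  Dualizing a
    coresolution of D(M) gives a resolution P of M whose terms are projective and
    injective.  Then Hom_A(P, A) = D(P) is exact, hence Ext^i(M, A) = 0 for i >= 1.
    The transpose of M is the cokernel of D(P_0) -> D(P_1); it is resolved by the
    duals of P_1, P_0 and of the coresolution of M, which are projective and
    injective again, so the same argument applies to it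
    ([infinite_dimensions_Gorenstein_projective]).  Over the opposite algebra this
    shows that D(M) is Gorenstein-projective too.

    Conversely, let M and D(M) be Gorenstein-projective.  Then M is reflexive
    ([Gorenstein_projective_reflexive]), so M = Hom_A(D(A), M) by means of c; this
    embeds M in a power of A, hence in a projective-injective module, and the
    injective hull J of M is projective.  As Ext^1(D(M), A) = 0, maps from D(A) to
    J / M lift to J, so J / M = Hom_A(D(A), J / M) as well, and Ext^i(D(J / M), A)
    is Ext^(i+1)(D(M), A) = 0.  Thus the step can be repeated, and all terms of the
    minimal injective coresolution of M are projective
    ([Gorenstein_domdim_infinite]).  The codominant dimension of M is handled by
    the same argument applied to D(M). *)

(** * Choice and linear algebra *)

Lemma choice_fun (S : Type) (T : S -> Type) (R : forall x, T x -> Prop) :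
  (forall x, exists y, R x y) -> exists f, forall x, R x (f x).
Proof.
move=> ex; exists (fun x => proj1_sig (constructive_indefinite_description _ (ex x))).
by move=> x; case: constructive_indefinite_description.
Qed.

(** Chain maps, homotopies and the like are built degree by degree: the invariant
    [I] makes the next step possible, [R] is the compatibility of two consecutive
    terms. *)
Lemma dependent_choice (T : nat -> Type) (I : forall n, T n -> Prop)
    (R : forall n, T n -> T n.+1 -> Prop) (x0 : T 0%N) :
  I 0%N x0 -> (forall n x, I n x -> exists y, I n.+1 y /\ R n x y) ->
  exists x : forall n, T n,
    [/\ x 0%N = x0, forall n, I n (x n) & forall n, R n (x n) (x n.+1)].
Proof.
move=> I0 ex.
have [f fP] : exists f : forall n (s : {x : T n | I n x}), T n.+1,
    forall n s, I n.+1 (f n s) /\ R n (proj1_sig s) (f n s).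
  have [f fP] := choice_fun (fun p : {n & {x : T n | I n x}} =>
    ex (projT1 p) (proj1_sig (projT2 p)) (proj2_sig (projT2 p))).
  by exists (fun n s => f (existT _ n s)) => n s; apply: (fP (existT _ n s)).
pose s := fix s n : {x : T n | I n x} :=
  if n is m.+1 then exist _ (f m (s m)) (proj1 (fP m (s m)))
  else exist _ x0 I0.
exists (fun n => proj1_sig (s n)); split=> // n; first exact: (proj2_sig (s n)).
exact: (proj2 (fP n (s n))).
Qed.

Section LinearMaps.
Variables (K : fieldType).
Implicit Types U V W : vectType K.

Definition mkhom U V (f : U -> V) (lf : linear f) : 'Hom(U, V) :=
  linfun (HB.pack_for {linear U -> V} f
    (GRing.isSemilinear.Build K U V _ f (GRing.semilinear_linear lf))).

Lemma mkhomE U V (f : U -> V) (lf : linear f) x : mkhom lf x = f x.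
Proof. by rewrite /mkhom lfunE. Qed.

(** Most linear maps below are given by a property that determines their values
    uniquely; if the property is linear, so is the map. *)
Lemma lfun_of_rel U V (R : U -> V -> Prop) :
  (forall x, exists y, R x y) ->
  (forall x y y', R x y -> R x y' -> y = y') ->
  (forall k x x' y y', R x y -> R x' y' -> R (k *: x + x') (k *: y + y')) ->
  exists f : 'Hom(U, V), forall x, R x (f x).
Proof.
move=> /choice_fun[f fR] Runiq Rlin.
have lf : linear f by move=> k x y; apply: Runiq (fR _) (Rlin _ _ _ _ _ _ _).
by exists (mkhom lf) => x; rewrite mkhomE.
Qed.

Lemma limgP U V (f : 'Hom(U, V)) : limg f = fullv <-> forall y, exists x, f x = y.
Proof.
split=> [fS y | fS].
  have : y \in limg f by rewrite fS memvf.
  by case/memv_imgP=> x _ ->; exists x.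
apply/vspaceP=> y; rewrite memvf; case: (fS y) => x <-.
by rewrite memv_img ?memvf.
Qed.

Lemma lker0_eq0 U V (f : 'Hom(U, V)) :
  (lker f = 0)%VS <-> forall x, f x = 0 -> x = 0.
Proof.
split=> [f0 x fx0 | f0].
  by apply/eqP; rewrite -memv0 -f0 memv_ker fx0.
apply/vspaceP=> x; rewrite memv_ker memv0.
by apply/eqP/eqP=> [/f0 | ->]; rewrite ?linear0.
Qed.

Lemma ker0_inj U V (f : 'Hom(U, V)) :
  (forall x, f x = 0 -> x = 0) -> forall x y, f x = f y -> x = y.
Proof.
move=> f0 x y fxy; apply/eqP; rewrite -subr_eq0; apply/eqP/f0.
by rewrite linearB /= fxy subrr.
Qed.

Lemma limg_lker U V W (f : 'Hom(U, V)) (g : 'Hom(V, W)) :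
  limg f = lker g <->
  (forall x, g (f x) = 0) /\ (forall y, g y = 0 -> exists x, f x = y).
Proof.
split=> [fg | [gf0 fg]].
  split=> [x | y gy0].
    by apply/eqP; rewrite -memv_ker -fg memv_img ?memvf.
  have : y \in limg f by rewrite fg memv_ker gy0.
  by case/memv_imgP=> x _ ->; exists x.
apply/vspaceP=> y; rewrite memv_ker.
apply/idP/eqP=> [/memv_imgP[x _ ->] // | /fg[x <-]].
by rewrite memv_img ?memvf.
Qed.

Lemma lfun_factor U V W (f : 'Hom(U, W)) (g : 'Hom(U, V)) :
  (forall x, g x = 0 -> f x = 0) ->
  exists h : 'Hom(V, W), forall x, f x = h (g x).
Proof.
move=> gf; exists (f \o g^-1)%VF => x; rewrite !comp_lfunE.
apply/eqP; rewrite -subr_eq0 -linearB; apply/eqP/gf.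
by rewrite linearB /= limg_lfunVK ?subrr // memv_img ?memvf.
Qed.

Local Notation D V := 'Hom(V, K^o).

Lemma separate_point V (x : V) : (forall g : D V, g x = 0) -> x = 0.
Proof.
move=> gx0; rewrite (coord_vbasis (memvf x)).
apply: big1 => i _.
suff -> : coord (vbasis {:V}) i x = 0 by rewrite scale0r.
have := gx0 (linfun (coord (vbasis {:V}) i : V -> K^o)).
by rewrite lfunE.
Qed.

Lemma functional_eval V (L : D (D V)) : exists x, forall g, L g = g x.
Proof.
pose e := vbasis {:V}; pose c i : D V := linfun (coord e i : V -> K^o).
exists (\sum_(i < \dim {:V}) L (c i) *: e`_i) => g.
have -> : g = \sum_(i < \dim {:V}) (g e`_i : K) *: c i.
  apply/lfunP=> x; rewrite {1}(coord_vbasis (memvf x)) linear_sum sum_lfunE.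
  apply: eq_bigr => i _; rewrite linearZ scale_lfunE lfunE /=.
  by rewrite /GRing.scale /= mulrC.
rewrite !linear_sum; apply: eq_bigr => i _; rewrite !linearZ /=.
rewrite sum_lfunE (bigD1 i) //= big1 ?addr0 => [|j ji].
  rewrite scale_lfunE lfunE /= coord_free ?(basis_free (vbasisP _)) //.
  by rewrite eqxx /GRing.scale /= mulr1 mulrC.
rewrite scale_lfunE lfunE /= coord_free ?(basis_free (vbasisP _)) //.
have -> : (i == j) = false by rewrite eq_sym; apply/negbTE.
exact: scaler0.
Qed.

Fact tr_is_linear U V (f : 'Hom(U, V)) : linear (fun g : D V => (g \o f)%VF).
Proof. by move=> k g h; rewrite comp_lfunDl comp_lfunZl. Qed.

Definition tr U V (f : 'Hom(U, V)) : 'Hom(D V, D U) := mkhom (tr_is_linear f).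

Lemma trE U V (f : 'Hom(U, V)) g x : tr f g x = g (f x).
Proof. by rewrite mkhomE comp_lfunE. Qed.

Fact flip_subproof U V (f : 'Hom(U, D V)) (y : V) :
  linear (fun x => f x y : K^o).
Proof. by move=> k x x'; rewrite linearP /= add_lfunE scale_lfunE. Qed.

Fact flip_is_linear U V (f : 'Hom(U, D V)) :
  linear (fun y => mkhom (flip_subproof f y)).
Proof.
move=> k y y'; apply/lfunP=> x.
by rewrite add_lfunE scale_lfunE !mkhomE linearP.
Qed.

Definition flip U V (f : 'Hom(U, D V)) : 'Hom(V, D U) :=
  mkhom (flip_is_linear f).

Lemma flipE U V (f : 'Hom(U, D V)) x y : flip f y x = f x y.
Proof. by rewrite !mkhomE. Qed.

(** Finite dimension enters here: functionals on a dual are evaluations, so a map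
    out of a dual space is a transpose. *)
Lemma untranspose U V (f : 'Hom(D V, U)) :
  exists g : 'Hom(D U, V), forall (h : D U) (l : D V), l (g h) = h (f l).
Proof.
apply: (lfun_of_rel (R := fun (h : D U) (x : V) => forall l : D V, l x = h (f l))).
- move=> h; have [x xP] := functional_eval (h \o f)%VF.
  by exists x => l; rewrite -xP comp_lfunE.
- move=> h x y xP yP; apply/eqP; rewrite -subr_eq0; apply/eqP.
  by apply: separate_point => l; rewrite linearB /= xP yP subrr.
- by move=> k h h' x y xP yP l; rewrite linearP /= add_lfunE scale_lfunE xP yP.
Qed.

Lemma tr_exact U V W (f : 'Hom(U, V)) (g : 'Hom(V, W)) :
  limg f = lker g -> limg (tr g) = lker (tr f).
Proof.
move/limg_lker=> [gf fg]; apply/limg_lker; split=> [h | h hf].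
  by apply/lfunP=> x; rewrite !trE gf linear0 zero_lfunE.
have [x /fg[y <-] | k kP] := @lfun_factor V W K^o h g.
  by rewrite -trE hf zero_lfunE.
by exists k; apply/lfunP=> x; rewrite trE -kP.
Qed.

Lemma tr_inj U V (f : 'Hom(U, V)) : limg f = fullv -> (lker (tr f) = 0)%VS.
Proof.
move/limgP=> fS; apply/lker0_eq0=> h hf; apply/lfunP=> y.
by have [x <-] := fS y; rewrite -trE hf !zero_lfunE.
Qed.

Lemma tr_surj U V (f : 'Hom(U, V)) : (lker f = 0)%VS -> limg (tr f) = fullv.
Proof.
move/lker0_eq0=> fI; apply/limgP=> h.
have [x /fI-> | k kP] := @lfun_factor U V K^o h f; first by rewrite linear0.
by exists k; apply/lfunP=> x; rewrite trE -kP.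
Qed.

End LinearMaps.

(** * Submodules, quotients and homomorphisms *)

Section ModuleBasics.
Variables (K : fieldType) (A : falgType K).
Implicit Types M N P Q X Y Z : rmodule A.

Definition orbit_map M (x : M) : 'Hom(A, M) := mkhom (ract_linr x).

Lemma orbit_mapE M (x : M) a : orbit_map x a = ract x a.
Proof. exact: mkhomE. Qed.

Lemma ractDl M (x y : M) a : ract (x + y) a = ract x a + ract y a.
Proof. by rewrite -!ract_endE linearD. Qed.

Lemma ractBl M (x y : M) a : ract (x - y) a = ract x a - ract y a.
Proof. by rewrite -!ract_endE linearB. Qed.

Lemma ractZl M k (x : M) a : ract (k *: x) a = k *: ract x a.
Proof. by rewrite -!ract_endE linearZ. Qed.

Lemma ract0l M a : ract (0 : M) a = 0.
Proof. by rewrite -ract_endE linear0. Qed.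

Lemma ract_suml M (I : finType) (x : I -> M) a :
  ract (\sum_i x i) a = \sum_i ract (x i) a.
Proof.
rewrite -ract_endE linear_sum.
by apply: eq_bigr => i _; rewrite /= ract_endE.
Qed.

Lemma ractDr M (x : M) a b : ract x (a + b) = ract x a + ract x b.
Proof. by rewrite -!orbit_mapE linearD. Qed.

Lemma ractZr M (x : M) k a : ract x (k *: a) = k *: ract x a.
Proof. by rewrite -!orbit_mapE linearZ. Qed.

Lemma ract0r M (x : M) : ract x 0 = 0.
Proof. by rewrite -orbit_mapE linear0. Qed.

Lemma ract_sumr M (I : finType) (x : M) (a : I -> A) :
  ract x (\sum_i a i) = \sum_i ract x (a i).
Proof.
rewrite -orbit_mapE linear_sum.
by apply: eq_bigr => i _; rewrite /= orbit_mapE.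
Qed.

Lemma HomA_ract M N (f : 'Hom(M, N)) x a :
  f \in HomA M N -> f (ract x a) = ract (f x) a.
Proof. by move/HomAP. Qed.

Lemma HomA_comp M N P (g : 'Hom(N, P)) (f : 'Hom(M, N)) :
  f \in HomA M N -> g \in HomA N P -> (g \o f)%VF \in HomA M P.
Proof.
move=> fH gH; apply/HomAP=> x a.
by rewrite !comp_lfunE (HomA_ract _ _ fH) (HomA_ract _ _ gH).
Qed.

Lemma HomA_id M : \1%VF \in HomA M M.
Proof. by apply/HomAP=> x a; rewrite !id_lfunE. Qed.

Lemma lkerHom_submod M N (f : 'Hom(M, N)) : f \in HomA M N -> is_submod (lker f).
Proof.
move=> fH x a; rewrite !memv_ker => /eqP fx.
by rewrite (HomA_ract _ _ fH) fx ract0l.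
Qed.

Lemma limgHom_submod M N (f : 'Hom(M, N)) : f \in HomA M N -> is_submod (limg f).
Proof.
move=> fH _ a /memv_imgP[x _ ->].
by rewrite -(HomA_ract _ _ fH) memv_img ?memvf.
Qed.

Definition subrmod M (U : {vspace M}) (sU : is_submod U) : rmodule A.
Proof.
refine (@RModule K A (subvs_of U) (fun u a => Subvs (sU _ a (subvsP u))) _ _ _ _).
- by move=> a k u v; apply: subvs_inj; rewrite /= ractDl ractZl.
- by move=> u k a b; apply: subvs_inj; rewrite /= ractDr ractZr.
- by move=> u; apply: subvs_inj; rewrite /= ract1.
- by move=> u a b; apply: subvs_inj; rewrite /= ractM.
Defined.

Definition sub_incl M (U : {vspace M}) (sU : is_submod U) :
  'Hom(subrmod sU, M) := linfun (vsval : subvs_of U -> M).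

Section Subrmod.
Variables (M : rmodule A) (U : {vspace M}) (sU : is_submod U).

Lemma sub_inclE u : sub_incl sU u = vsval u.
Proof. by rewrite lfunE. Qed.

Lemma sub_incl_in u : sub_incl sU u \in U.
Proof. by rewrite sub_inclE subvsP. Qed.

Lemma sub_incl_onto x : x \in U -> exists u, sub_incl sU u = x.
Proof. by move=> xU; exists (vsproj U x); rewrite sub_inclE vsprojK. Qed.

Lemma sub_incl_hom : sub_incl sU \in HomA (subrmod sU) M.
Proof. by apply/HomAP=> x a; rewrite !sub_inclE. Qed.

Lemma sub_incl_eq0 u : sub_incl sU u = 0 -> u = 0.
Proof. by rewrite sub_inclE => u0; apply: subvs_inj; rewrite u0 linear0. Qed.

Lemma limg_sub_incl : limg (sub_incl sU) = U.
Proof.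
apply/vspaceP=> x; apply/memv_imgP/idP=> [[u _ ->] | /sub_incl_onto[u <-]].
  exact: sub_incl_in.
by exists u; rewrite ?memvf.
Qed.

Lemma sub_corestrict X (f : 'Hom(X, M)) :
  f \in HomA X M -> (forall x, f x \in U) ->
  exists2 g, g \in HomA X (subrmod sU) & forall x, f x = sub_incl sU (g x).
Proof.
move=> fH fU; have lg : linear (fun x => vsproj U (f x)).
  by move=> k x y; rewrite !linearP.
have gE x : f x = sub_incl sU (mkhom lg x) by rewrite mkhomE sub_inclE vsprojK.
exists (mkhom lg) => //; apply/HomAP=> x a; apply: subvs_inj.
by rewrite -sub_inclE -gE (HomA_ract _ _ fH) gE sub_inclE.
Qed.

End Subrmod.

Section Quotient.
Variables (M : rmodule A) (U : {vspace M}) (sU : is_submod U).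

Definition quot_proj : 'Hom(M, subvs_of (U^C)%VS) :=
  (linfun (vsproj (U^C)) \o (\1 - projv U))%VF.

Lemma quot_projE x : vsval (quot_proj x) = x - projv U x.
Proof.
by rewrite comp_lfunE add_lfunE opp_lfunE id_lfunE lfunE /= vsprojK // memv_projC.
Qed.

Lemma quot_proj_eq0 x : quot_proj x = 0 <-> x \in U.
Proof.
split=> [x0 | xU].
  have /esym/eqP := quot_projE x; rewrite x0 linear0 subr_eq0 => /eqP->.
  exact: memv_proj.
by apply: subvs_inj; rewrite quot_projE projv_id // subrr linear0.
Qed.

Lemma quot_proj_val v : quot_proj (vsval v) = v.
Proof.
apply: subvs_inj; rewrite /= quot_projE.
suff -> : projv U (vsval v) = 0 by rewrite subr0.
apply/eqP; rewrite -memv0 -(capv_compl U) memv_cap memv_proj /=.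
have := memv_projC U (vsval v); rewrite -[X in X - _]opprK -opprD rpredN addrC.
by rewrite rpredBr ?subvsP.
Qed.

Lemma quot_proj_eq x y : quot_proj x = quot_proj y <-> x - y \in U.
Proof.
rewrite -quot_proj_eq0 linearB /=.
by split=> [-> | /eqP]; rewrite ?subrr // subr_eq0 => /eqP.
Qed.

Lemma quot_proj_act x a :
  quot_proj (ract (vsval (quot_proj x)) a) = quot_proj (ract x a).
Proof.
apply/quot_proj_eq; rewrite -ractBl; apply: sU.
by apply/quot_proj_eq; rewrite quot_proj_val.
Qed.

(** Carried by the complement [U^C], which makes the quotient a [vectType]. *)
Definition quotmod : rmodule A.
Proof.
refine (@RModule K A (subvs_of (U^C)%VS)
          (fun v a => quot_proj (ract (vsval v) a)) _ _ _ _).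
- by move=> a k u v; rewrite linearP ractDl ractZl linearP.
- by move=> u k a b; rewrite ractDr ractZr linearP.
- by move=> u; rewrite ract1 quot_proj_val.
- by move=> u a b; rewrite ractM quot_proj_act.
Defined.

Definition quot_map : 'Hom(M, quotmod) := quot_proj.

Lemma quot_map_eq0 x : quot_map x = 0 <-> x \in U.
Proof. exact: quot_proj_eq0. Qed.

Lemma quot_map_onto v : exists x, quot_map x = v.
Proof. by exists (vsval v); apply: quot_proj_val. Qed.

Lemma quot_map_hom : quot_map \in HomA M quotmod.
Proof. by apply/HomAP=> x a; rewrite /= quot_proj_act. Qed.

End Quotient.

Lemma hom_factor M N P (f : 'Hom(M, P)) (g : 'Hom(M, N)) :
  f \in HomA M P -> g \in HomA M N -> (forall y, exists x, g x = y) ->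
  (forall x, g x = 0 -> f x = 0) ->
  exists2 h, h \in HomA N P & forall x, f x = h (g x).
Proof.
move=> fH gH gS gf; have [h hP] := lfun_factor gf; exists h => //.
apply/HomAP=> y a; have [x <-] := gS y.
by rewrite -(HomA_ract _ _ gH) -!hP (HomA_ract _ _ fH).
Qed.

(** * Projective and injective modules *)

Lemma proj_lift P M N (g : 'Hom(M, N)) (f : 'Hom(P, N)) :
  is_projective P -> g \in HomA M N -> (forall y, exists x, g x = y) ->
  f \in HomA P N -> exists2 h, h \in HomA P M & forall x, f x = g (h x).
Proof.
move=> pP gH gS fH; have [h hH fE] := pP M N g f gH (proj2 (limgP g) gS) fH.
by exists h => // x; rewrite fE comp_lfunE.
Qed.

Lemma inj_extend Q M N (g : 'Hom(M, N)) (f : 'Hom(M, Q)) :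
  is_injective Q -> g \in HomA M N -> (forall x, g x = 0 -> x = 0) ->
  f \in HomA M Q -> exists2 h, h \in HomA N Q & forall x, f x = h (g x).
Proof.
move=> iI gH gI fH; have [h hH fE] := iI M N g f gH (proj2 (lker0_eq0 g) gI) fH.
by exists h => // x; rewrite fE comp_lfunE.
Qed.

Lemma proj_lift_exact P X Y Z (d : 'Hom(X, Y)) (e : 'Hom(Y, Z)) (f : 'Hom(P, Y)) :
  is_projective P -> d \in HomA X Y -> e \in HomA Y Z -> limg d = lker e ->
  f \in HomA P Y -> (forall x, e (f x) = 0) ->
  exists2 h, h \in HomA P X & forall x, f x = d (h x).
Proof.
move=> pP dH eH /limg_lker[ed de] fH ef; have sK := lkerHom_submod eH.
have [d' d'H dE] : exists2 d', d' \in HomA X (subrmod sK) &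
    forall x, d x = sub_incl sK (d' x).
  by apply: sub_corestrict => // x; rewrite memv_ker ed.
have [f' f'H fE] : exists2 f', f' \in HomA P (subrmod sK) &
    forall x, f x = sub_incl sK (f' x).
  by apply: sub_corestrict => // x; rewrite memv_ker ef.
have d'S y : exists x, d' x = y.
  have := sub_incl_in y; rewrite memv_ker => /eqP/de[x dx].
  by exists x; apply: (ker0_inj (@sub_incl_eq0 _ _ sK)); rewrite -dE dx.
have [h hH hE] := proj_lift pP d'H d'S f'H.
by exists h => // x; rewrite dE fE hE.
Qed.

Definition retract_of P Q : Prop :=
  exists (i : 'Hom(P, Q)) (r : 'Hom(Q, P)),
    [/\ i \in HomA P Q, r \in HomA Q P & forall x, r (i x) = x].

Lemma retract_projective P Q : retract_of P Q -> is_projective Q -> is_projective P.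
Proof.
move=> [i [r [iH rH ri]]] pQ M N g f gH /limgP gS fH.
have [h hH hE] := proj_lift pQ gH gS (HomA_comp rH fH).
exists (h \o i)%VF; first exact: HomA_comp.
by apply/lfunP=> x; rewrite !comp_lfunE -hE comp_lfunE ri.
Qed.

Lemma retract_injective P Q : retract_of P Q -> is_injective Q -> is_injective P.
Proof.
move=> [i [r [iH rH ri]]] iQ M N g f gH /lker0_eq0 gI fH.
have [h hH hE] := inj_extend iQ gH gI (HomA_comp fH iH).
exists (r \o h)%VF; first exact: HomA_comp.
by apply/lfunP=> x; rewrite !comp_lfunE -hE comp_lfunE ri.
Qed.

Lemma inj_retract Q X (i : 'Hom(Q, X)) :
  is_injective Q -> i \in HomA Q X -> (forall x, i x = 0 -> x = 0) ->
  exists2 r, r \in HomA X Q & forall x, r (i x) = x.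
Proof.
move=> iQ iH iI; have [r rH rE] := inj_extend iQ iH iI (HomA_id Q).
by exists r => // x; rewrite -rE id_lfunE.
Qed.

(** Finitely generated projective modules are those with a dual basis.  It turns
    arguments on free modules and their summands into explicit sums. *)
Definition dual_basis P n (e : 'I_n -> P) (l : 'I_n -> 'Hom(P, regmod A)) : Prop :=
  (forall i, l i \in HomA P (regmod A)) /\
  (forall x, x = \sum_i ract (e i) (l i x)).

Lemma dual_basis_projective P n (e : 'I_n -> P) l :
  dual_basis e l -> is_projective P.
Proof.
move=> [lH eP] M N g f gH /limgP gS fH.
have [m mP] := choice_fun (fun i => gS (f (e i))).
have lh : linear (fun x => \sum_i ract (m i) (l i x)).
  move=> k x y; rewrite scaler_sumr -big_split /=; apply: eq_bigr => i _.
  by rewrite linearP ractDr ractZr.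
exists (mkhom lh).
  apply/HomAP=> x a; rewrite !mkhomE ract_suml; apply: eq_bigr => i _.
  by rewrite (HomA_ract _ _ (lH i)) ractM.
apply/lfunP=> x; rewrite comp_lfunE mkhomE {1}[x]eP !linear_sum.
by apply: eq_bigr => i _; rewrite /= (HomA_ract _ _ fH) (HomA_ract _ _ gH) mP.
Qed.

Section Powers.
Variables (N : rmodule A) (n : nat).

Fact pow_proj_is_linear (i : 'I_n) :
  linear (fun x : powmod N n => (x : {ffun 'I_n -> N}) i).
Proof. by move=> k x y; rewrite !ffunE. Qed.

Definition pow_proj i : 'Hom(powmod N n, N) := mkhom (pow_proj_is_linear i).

Lemma pow_projE i (x : {ffun 'I_n -> N}) : pow_proj i x = x i.
Proof. exact: mkhomE. Qed.

Lemma pow_proj_hom i : pow_proj i \in HomA (powmod N n) N.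
Proof. by apply/HomAP=> x a; rewrite !pow_projE ffunE. Qed.

Lemma pow_ext (x y : powmod N n) : (forall i, pow_proj i x = pow_proj i y) -> x = y.
Proof. by move=> xy; apply/ffunP=> i; have := xy i; rewrite !pow_projE. Qed.

Lemma pow_pair M (f : 'I_n -> 'Hom(M, N)) :
  (forall i, f i \in HomA M N) ->
  exists2 g, g \in HomA M (powmod N n) & forall i x, pow_proj i (g x) = f i x.
Proof.
move=> fH; have lg : linear (fun x => [ffun i => f i x] : powmod N n).
  by move=> k x y; apply/ffunP=> i; rewrite !ffunE linearP.
exists (mkhom lg); last by move=> i x; rewrite [mkhom lg x]mkhomE pow_projE ffunE.
by apply/HomAP=> x a; apply/ffunP=> i; rewrite !mkhomE !ffunE (HomA_ract _ _ (fH i)).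
Qed.

Fact pow_inj_is_linear (i : 'I_n) :
  linear (fun x : N => [ffun j => if j == i then x else 0] : powmod N n).
Proof.
by move=> k x y; apply/ffunP=> j; rewrite !ffunE; case: eqP; rewrite // scaler0 addr0.
Qed.

Definition pow_inj i : 'Hom(N, powmod N n) := mkhom (pow_inj_is_linear i).

Lemma pow_inj_hom i : pow_inj i \in HomA N (powmod N n).
Proof.
apply/HomAP=> x a; apply/ffunP=> j; rewrite !mkhomE !ffunE.
by case: eqP; rewrite // ract0l.
Qed.

Lemma pow_proj_inj i j x : pow_proj j (pow_inj i x) = if j == i then x else 0.
Proof. by rewrite pow_projE /pow_inj mkhomE ffunE. Qed.

Lemma pow_decomp (x : powmod N n) : x = \sum_i pow_inj i (pow_proj i x).
Proof.
apply: pow_ext => j; rewrite linear_sum (bigD1 j) //= big1 => [|i ij].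
  by rewrite addr0 pow_proj_inj eqxx.
by rewrite pow_proj_inj eq_sym (negbTE ij).
Qed.

Lemma pow_projective : is_projective N -> is_projective (powmod N n).
Proof.
move=> pN X Y g f gH /limgP gS fH.
have ex i : exists h, h \in HomA N X /\ forall x, f (pow_inj i x) = g (h x).
  have [h hH hE] := proj_lift pN gH gS (HomA_comp (pow_inj_hom i) fH).
  by exists h; split=> // x; rewrite -hE comp_lfunE.
have [h hP] := choice_fun ex.
exists (\sum_i (h i \o pow_proj i))%VF.
  by apply: rpred_sum => i _; apply: HomA_comp (pow_proj_hom i) (proj1 (hP i)).
apply/lfunP=> x; rewrite comp_lfunE sum_lfunE {1}[x]pow_decomp !linear_sum.
by apply: eq_bigr => i _; rewrite /= comp_lfunE (proj2 (hP i)).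
Qed.

Lemma pow_injective : is_injective N -> is_injective (powmod N n).
Proof.
move=> iN X Y g f gH /lker0_eq0 gI fH.
have ex i : exists h, h \in HomA Y N /\ forall x, pow_proj i (f x) = h (g x).
  have [h hH hE] := inj_extend iN gH gI (HomA_comp fH (pow_proj_hom i)).
  by exists h; split=> // x; rewrite -hE comp_lfunE.
have [h hP] := choice_fun ex.
have [k kH kE] := pow_pair (fun i => proj1 (hP i)).
exists k => //; apply/lfunP=> x; apply: pow_ext => i.
by rewrite comp_lfunE kE (proj2 (hP i)).
Qed.

End Powers.

Lemma regmod_dual_basis : dual_basis (fun _ : 'I_1 => (1 : A) : regmod A) (fun=> \1%VF).
Proof.
split=> [_ | x]; first exact: HomA_id.
by rewrite big_ord1 id_lfunE /= mul1r.
Qed.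

Lemma free_cover X : exists n, exists2 f, f \in HomA (powmod (regmod A) n) X &
  forall y, exists x, f x = y.
Proof.
pose e := vbasis {:X}; exists (\dim {:X}).
pose f i := (orbit_map (e`_i) : 'Hom(regmod A, X)).
have fH i : f i \in HomA (regmod A) X.
  by apply/HomAP=> x a; rewrite !orbit_mapE ractM.
exists (\sum_(i < \dim {:X}) (f i \o pow_proj (regmod A) i))%VF.
  by apply: rpred_sum => i _; apply: HomA_comp (pow_proj_hom _ i) (fH i).
move=> y.
exists (\sum_(i < \dim {:X}) pow_inj (regmod A) i (coord e i y *: (1 : A))).
rewrite sum_lfunE {2}(coord_vbasis (memvf y)); apply: eq_bigr => i _.
rewrite comp_lfunE linear_sum (bigD1 i) //= big1 => [|j ji].
  by rewrite addr0 (@pow_proj_inj (regmod A)) eqxx orbit_mapE ractZr ract1.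
by rewrite (@pow_proj_inj (regmod A)) eq_sym (negbTE ji).
Qed.

Lemma free_projective n : is_projective (powmod (regmod A) n).
Proof. exact/pow_projective/dual_basis_projective/regmod_dual_basis. Qed.

Lemma projective_dual_basis P :
  is_projective P -> exists n (e : 'I_n -> P) l, dual_basis e l.
Proof.
move=> pP; have [n [f fH fS]] := free_cover P.
have [s sH sE] := proj_lift pP fH fS (HomA_id P).
exists n, (fun i => f (pow_inj (regmod A) i (1 : A))),
  (fun i => pow_proj (regmod A) i \o s)%VF.
split=> [i | x]; first exact: HomA_comp sH (pow_proj_hom _ i).
rewrite -[LHS]id_lfunE sE [s x in LHS]pow_decomp linear_sum.
apply: eq_bigr => i _.
rewrite comp_lfunE -(HomA_ract _ _ fH) -(HomA_ract _ _ (pow_inj_hom _ i)).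
by rewrite /= mul1r.
Qed.

End ModuleBasics.

(** * Duality *)

Section DoubleOpposite.
Variables (K : fieldType) (A : falgType K).

(** [A] and [(A^c)^c] have the same operations but are different algebras as
    structures; [upmod] and [downmod] carry modules across. *)
Definition upmod (M : rmodule A) : rmodule (A^c)^c.
Proof.
refine (@RModule K (A^c)^c M (fun x a => ract x (a : A)) _ _ _ _).
- exact: (@ract_linl _ _ M).
- exact: (@ract_linr _ _ M).
- exact: (@ract1 _ _ M).
- exact: (@ractM _ _ M).
Defined.

Definition downmod (M : rmodule (A^c)^c) : rmodule A.
Proof.
refine (@RModule K A M (fun x (a : A) => @ract _ _ M x (a : (A^c)^c)) _ _ _ _).
- exact: (@ract_linl _ _ M).
- exact: (@ract_linr _ _ M).
- exact: (@ract1 _ _ M).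
- exact: (@ractM _ _ M).
Defined.

Lemma HomA_up (M N : rmodule A) (f : 'Hom(M, N)) :
  (f \in HomA (upmod M) (upmod N)) = (f \in HomA M N).
Proof. by apply/HomAP/HomAP. Qed.

Lemma HomA_down (M N : rmodule (A^c)^c) (f : 'Hom(M, N)) :
  (f \in HomA (downmod M) (downmod N)) = (f \in HomA M N).
Proof. by apply/HomAP/HomAP. Qed.

Lemma HomA_up_down (M : rmodule A) (N : rmodule (A^c)^c) (f : 'Hom(M, N)) :
  (f \in HomA (upmod M) N) = (f \in HomA M (downmod N)).
Proof. by apply/HomAP/HomAP. Qed.

Lemma HomA_down_up (M : rmodule (A^c)^c) (N : rmodule A) (f : 'Hom(M, N)) :
  (f \in HomA (downmod M) N) = (f \in HomA M (upmod N)).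
Proof. by apply/HomAP/HomAP. Qed.

Lemma down_projective (P : rmodule (A^c)^c) : is_projective P -> is_projective (downmod P).
Proof.
move=> pP M N g f gH gS fH; rewrite HomA_down_up in fH.
have [h hH hE] := pP (upmod M) (upmod N) g f (etrans (HomA_up g) gH) gS fH.
by exists h; rewrite ?HomA_down_up.
Qed.

Lemma up_projective (P : rmodule A) : is_projective P -> is_projective (upmod P).
Proof.
move=> pP M N g f gH gS fH; rewrite HomA_up_down in fH.
have [h hH hE] := pP (downmod M) (downmod N) g f (etrans (HomA_down g) gH) gS fH.
by exists h; rewrite ?HomA_up_down.
Qed.

Lemma down_injective (Q : rmodule (A^c)^c) : is_injective Q -> is_injective (downmod Q).
Proof.
move=> pP M N g f gH gS fH; rewrite -HomA_up_down in fH.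
have [h hH hE] := pP (upmod M) (upmod N) g f (etrans (HomA_up g) gH) gS fH.
by exists h; rewrite -?HomA_up_down.
Qed.

Lemma up_injective (Q : rmodule A) : is_injective Q -> is_injective (upmod Q).
Proof.
move=> pP M N g f gH gS fH; rewrite -HomA_down_up in fH.
have [h hH hE] := pP (downmod M) (downmod N) g f (etrans (HomA_down g) gH) gS fH.
by exists h; rewrite -?HomA_down_up.
Qed.

Definition codualmod (Y : rmodule A^c) : rmodule A := downmod (dualmod Y).

End DoubleOpposite.

Section Duality.
Variables (K : fieldType) (A : falgType K).
Implicit Types (M N P Q : rmodule A) (X Y Z : rmodule A^c).
Local Notation D V := 'Hom(V, K^o).

Lemma dual_ractE M (g : dualmod M) a (x : M) :
  (ract g a : D M) x = (g : D M) (ract x (a : A)).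
Proof. by rewrite /= comp_lfunE ract_endE. Qed.

Lemma codual_ractE Y (g : codualmod Y) a (y : Y) :
  (ract g a : D Y) y = (g : D Y) (ract y (a : A^c)).
Proof. by rewrite /= comp_lfunE ract_endE. Qed.

Lemma tr_dual M N (f : 'Hom(M, N)) :
  f \in HomA M N -> tr f \in HomA (dualmod N) (dualmod M).
Proof.
move=> fH; apply/HomAP=> g a; apply/lfunP=> x.
by rewrite trE !dual_ractE trE (HomA_ract _ _ fH).
Qed.

Lemma tr_codual X Y (f : 'Hom(X, Y)) :
  f \in HomA X Y -> tr f \in HomA (codualmod Y) (codualmod X).
Proof.
move=> fH; apply/HomAP=> g a; apply/lfunP=> x.
by rewrite trE !codual_ractE trE (HomA_ract _ _ fH).
Qed.

Lemma functional_ext (V : vectType K) (x y : V) :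
  (forall g : D V, g x = g y) -> x = y.
Proof.
move=> xy; apply/eqP; rewrite -subr_eq0; apply/eqP/separate_point => g.
by rewrite linearB /= xy subrr.
Qed.

Lemma untranspose_dual Q Y (f : 'Hom(dualmod Q, Y)) :
  f \in HomA (dualmod Q) Y ->
  exists2 g, g \in HomA (codualmod Y) Q &
    forall (h : D Y) (l : D Q), l (g h) = h (f l).
Proof.
move=> fH; have [g gE] := untranspose f; exists g => //.
apply/HomAP=> h a; apply: functional_ext => l.
by rewrite gE codual_ractE -(HomA_ract _ _ fH) -gE dual_ractE.
Qed.

Lemma untranspose_codual Q Y (f : 'Hom(codualmod Y, Q)) :
  f \in HomA (codualmod Y) Q ->
  exists2 g, g \in HomA (dualmod Q) Y &
    forall (h : D Q) (l : D Y), l (g h) = h (f l).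
Proof.
move=> fH; have [g gE] := untranspose f; exists g => //.
apply/HomAP=> h a; apply: functional_ext => l.
by rewrite gE dual_ractE -(HomA_ract _ _ fH) -gE codual_ractE.
Qed.

(** Transposition turns a lifting problem out of [D(Q)] into an extension problem
    into [Q]. *)
Lemma dual_projective Q : is_injective Q -> is_projective (dualmod Q).
Proof.
move=> iQ X Y g f gH gS fH; have [u uH uE] := untranspose_dual fH.
have [v vH vE] := inj_extend iQ (tr_codual gH) (proj1 (lker0_eq0 _) (tr_inj gS)) uH.
have [h hH hE] := untranspose_codual vH.
exists h => //; apply/lfunP=> l; apply: functional_ext => k.
by rewrite comp_lfunE -uE vE -hE trE.
Qed.

(** An extension problem into [D(P)] is a lifting problem out of [P], by exchanging
    the two arguments of the bilinear form attached to a map into [D(P)]. *)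
Lemma dual_injective P : is_projective P -> is_injective (dualmod P).
Proof.
move=> pP X Y g f gH gI fH.
have gtS := proj1 (limgP _) (tr_surj gI).
have uH : flip f \in HomA P (codualmod X).
  apply/HomAP=> x a; apply/lfunP=> y.
  by rewrite codual_ractE !flipE (HomA_ract _ _ fH) dual_ractE.
have [v vH vE] := proj_lift pP (tr_codual gH) gtS uH.
exists (flip (v : 'Hom(P, D Y))).
  apply/HomAP=> y a; apply/lfunP=> x.
  by rewrite dual_ractE !flipE (HomA_ract _ _ vH) codual_ractE.
apply/lfunP=> y; apply/lfunP=> x.
by rewrite comp_lfunE flipE -trE -vE flipE.
Qed.

Definition eval_map M : 'Hom(M, D (D M)) := flip \1%VF.

Lemma eval_mapE M (x : M) (g : D M) : eval_map M x g = g x.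
Proof. by rewrite flipE id_lfunE. Qed.

Lemma eval_map_eq0 M (x : M) : eval_map M x = 0 -> x = 0.
Proof.
by move=> x0; apply: separate_point => g; rewrite -eval_mapE x0 zero_lfunE.
Qed.

Lemma eval_map_onto M (L : D (D M)) : exists x, eval_map M x = L.
Proof.
have [x xP] := functional_eval L.
by exists x; apply/lfunP=> g; rewrite eval_mapE xP.
Qed.

End Duality.

Section Codual.
Variables (K : fieldType) (A : falgType K).
Implicit Types (M : rmodule A) (Y : rmodule A^c).

Lemma codual_projective Y : is_injective Y -> is_projective (codualmod Y).
Proof. by move=> iY; apply/down_projective/dual_projective. Qed.

Lemma codual_injective Y : is_projective Y -> is_injective (codualmod Y).
Proof. by move=> iY; apply/down_injective/dual_injective. Qed.

Lemma eval_map_hom M :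
  (eval_map M : 'Hom(M, codualmod (dualmod M))) \in HomA M (codualmod (dualmod M)).
Proof.
apply/HomAP=> x a; apply/lfunP=> g.
by rewrite codual_ractE !eval_mapE dual_ractE.
Qed.

End Codual.

(** * Resolutions and Ext *)

Section Ext.
Variables (K : fieldType) (A : falgType K).
Implicit Types (L M N P Q X : rmodule A).

(** The vanishing of Ext^(n+1)(M, N), computed from [P]. *)
Definition ext_vanishes M (P : proj_resolution M) N n : Prop :=
  forall f, f \in HomA (P n.+1) N -> (forall x, f (pres_d P n.+1 x) = 0) ->
  exists2 h, h \in HomA (P n) N & forall x, f x = h (pres_d P n x).

Lemma ext_vanishesP M (P : proj_resolution M) N n :
  cocycles P N n.+1 = coboundaries P N n.+1 <-> ext_vanishes P N n.
Proof.
split=> [cE f fH fd | van].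
  have : f \in cocycles P N n.+1.
    rewrite /cocycles memv_cap fH memv_ker lfunE /=; apply/eqP/lfunP=> x.
    by rewrite /precomp comp_lfunE fd zero_lfunE.
  rewrite cE => /memv_imgP[h hH ->]; exists h => // x.
  by rewrite lfunE /= /precomp comp_lfunE.
apply/vspaceP=> f; apply/idP/idP.
  rewrite /cocycles memv_cap memv_ker lfunE /= => /andP[fH /eqP fd].
  have fd0 x : f (pres_d P n.+1 x) = 0.
    have := congr1 (fun u : 'Hom(_, _) => u x) fd.
    by rewrite /precomp comp_lfunE zero_lfunE.
  have [h hH hE] := van f fH fd0; apply/memv_imgP; exists h => //.
  by apply/lfunP=> x; rewrite lfunE /= /precomp comp_lfunE hE.
case/memv_imgP=> h hH ->; rewrite lfunE /= /precomp /cocycles memv_cap.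
rewrite HomA_comp ?pres_d_hom //= memv_ker lfunE; apply/eqP/lfunP=> x.
rewrite /= /precomp !comp_lfunE zero_lfunE.
by have [-> _] := proj1 (limg_lker _ _) (pres_exact P n); rewrite linear0.
Qed.

Lemma pres_dd M (P : proj_resolution M) n x : pres_d P n (pres_d P n.+1 x) = 0.
Proof. by have [-> _] := proj1 (limg_lker _ _) (pres_exact P n). Qed.

Lemma pres_d_aug M (P : proj_resolution M) x : pres_aug P (pres_d P 0 x) = 0.
Proof. by have [-> _] := proj1 (limg_lker _ _) (pres_exact0 P). Qed.

(** The comparison theorem: what has been built in degree [n], composed with the
    differential, lands in a kernel, hence lifts through the next projective. *)
Lemma chain_map M (P Q : proj_resolution M) :
  exists u : forall n, 'Hom(P n, Q n),
    [/\ forall n, u n \in HomA (P n) (Q n),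
        forall x, pres_aug Q (u 0 x) = pres_aug P x &
        forall n x, pres_d Q n (u n.+1 x) = u n (pres_d P n x)].
Proof.
have [u0 u0H u0E] := proj_lift (@pres_proj _ _ _ P 0) (pres_aug_hom Q)
  (proj1 (limgP _) (pres_aug_surj Q)) (pres_aug_hom P).
pose I n : 'Hom(P n, Q n) -> Prop := match n with
  | 0 => fun u => u \in HomA (P 0) (Q 0) /\ forall x, pres_aug Q (u x) = pres_aug P x
  | m.+1 => fun u => u \in HomA (P m.+1) (Q m.+1) /\
               forall x, pres_d Q m (u (pres_d P m.+1 x)) = 0 end.
pose R n (u : 'Hom(P n, Q n)) (v : 'Hom(P n.+1, Q n.+1)) :=
  forall x, pres_d Q n (v x) = u (pres_d P n x).
have I0 : I 0%N u0 by split=> // x; rewrite -u0E.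
have step n u : I n u -> exists v, I n.+1 v /\ R n u v.
  move=> Iu; have uH : u \in HomA (P n) (Q n) by case: n u Iu => [|n] u [].
  have udH := HomA_comp (pres_d_hom P n) uH.
  have [v vH vE] : exists2 v, v \in HomA (P n.+1) (Q n.+1) &
      forall x, (u \o pres_d P n)%VF x = pres_d Q n (v x).
    case: n u Iu {uH} udH => [|n] u [_ uE] udH.
      apply: (proj_lift_exact (@pres_proj _ _ _ P 1) (pres_d_hom Q 0)
        (pres_aug_hom Q)) => //.
        exact: pres_exact0.
      by move=> x; rewrite comp_lfunE uE pres_d_aug.
    apply: (proj_lift_exact (@pres_proj _ _ _ P n.+2) (pres_d_hom Q n.+1)
      (pres_d_hom Q n)) => //.
      exact: pres_exact.
    by move=> x; rewrite comp_lfunE uE.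
  have Ruv : R n u v by move=> x; rewrite -vE comp_lfunE.
  by exists v; split=> //; split=> // x; rewrite Ruv pres_dd linear0.
have [u [u00 uI uR]] := dependent_choice I0 step.
exists u; split=> // [n|]; first by case: n (u n) (uI n) => [|n] v [].
by have [_] := uI 0%N.
Qed.

Lemma null_homotopy M (Q : proj_resolution M) (w : forall n, 'Hom(Q n, Q n)) :
  (forall n, w n \in HomA (Q n) (Q n)) ->
  (forall x, pres_aug Q (w 0 x) = 0) ->
  (forall n x, pres_d Q n (w n.+1 x) = w n (pres_d Q n x)) ->
  exists s : forall n, 'Hom(Q n, Q n.+1),
    [/\ forall n, s n \in HomA (Q n) (Q n.+1) &
        forall n x, w n.+1 x = pres_d Q n.+1 (s n.+1 x) + s n (pres_d Q n x)].
Proof.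
move=> wH w0 wd.
have [s0 s0H s0E] := proj_lift_exact (@pres_proj _ _ _ Q 0) (pres_d_hom Q 0)
  (pres_aug_hom Q) (pres_exact0 Q) (wH 0%N) w0.
pose I n (s : 'Hom(Q n, Q n.+1)) := s \in HomA (Q n) (Q n.+1) /\
  forall x, pres_d Q n (w n.+1 x - s (pres_d Q n x)) = 0.
pose R n (s : 'Hom(Q n, Q n.+1)) (t : 'Hom(Q n.+1, Q n.+2)) :=
  forall x, w n.+1 x - s (pres_d Q n x) = pres_d Q n.+1 (t x).
have I0 : I 0%N s0 by split=> // x; rewrite linearB /= wd -s0E subrr.
have step n s : I n s -> exists t, I n.+1 t /\ R n s t.
  move=> [sH sd].
  have [|||t tH tE] := @proj_lift_exact K A (Q n.+1) _ _ _ (pres_d Q n.+1) (pres_d Q n)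
     (w n.+1 - (s \o pres_d Q n))%VF (@pres_proj _ _ _ Q _) (pres_d_hom Q _) (pres_d_hom Q _).
  - exact: pres_exact.
  - by apply: memvB (wH _) _; apply: HomA_comp (pres_d_hom _ _) sH.
  - by move=> x; rewrite add_lfunE opp_lfunE comp_lfunE sd.
  have Rst : R n s t by move=> x; rewrite -tE add_lfunE opp_lfunE comp_lfunE.
  exists t; split=> //; split=> // x.
  by rewrite linearB /= wd -Rst pres_dd linear0 subr0 subrr.
have [s [_ sI sR]] := dependent_choice I0 step.
exists s; split=> n; first by have [] := sI n.
by move=> x; rewrite -sR subrK.
Qed.

(** With chain maps u : P -> Q and v : Q -> P over the identity of [M] and a
    homotopy s from u v to 1, a cocycle f on [Q] is f u v + f s d, and f u is a
    coboundary on [P]. *)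
Lemma ext_vanishes_indep M (P Q : proj_resolution M) N n :
  ext_vanishes P N n -> ext_vanishes Q N n.
Proof.
move=> van f fH fd.
have [u [uH u0 ud]] := chain_map P Q; have [v [vH v0 vd]] := chain_map Q P.
have [|||s [sH sE]] := @null_homotopy M Q (fun n => \1 - (u n \o v n))%VF.
- by move=> m; apply: memvB; [exact: HomA_id | exact: HomA_comp].
- by move=> x; rewrite add_lfunE opp_lfunE comp_lfunE id_lfunE linearB /= u0 v0 subrr.
- by move=> m x; rewrite !add_lfunE !opp_lfunE !comp_lfunE !id_lfunE linearB /= ud vd.
have [||h hH hE] := van (f \o u n.+1)%VF.
- exact: HomA_comp.
- by move=> x; rewrite comp_lfunE -ud fd.
exists ((h \o v n) + (f \o s n))%VF; first by apply: memvD; apply: HomA_comp.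
move=> x; have := sE n x; rewrite add_lfunE opp_lfunE comp_lfunE id_lfunE.
move/(congr1 f); rewrite linearB linearD /= fd add0r => /eqP.
rewrite subr_eq => /eqP->.
by rewrite add_lfunE !comp_lfunE -vd -hE comp_lfunE addrC.
Qed.

Lemma Ext_eq0S_vanishes M (Q : proj_resolution M) N n :
  Ext_eq0 n.+1 M N -> ext_vanishes Q N n.
Proof. by case=> P /ext_vanishesP; apply: ext_vanishes_indep. Qed.

Lemma proj_resolution_exists M : exists P : proj_resolution M, True.
Proof.
have cover X : exists c : {P : rmodule A & 'Hom(P, X)},
    is_projective (projT1 c) /\
    (projT2 c \in HomA (projT1 c) X /\ forall y, exists x, projT2 c x = y).
  have [n [f fH fS]] := free_cover X.
  by exists (existT _ (powmod (regmod A) n) f); split=> //; apply: free_projective.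
have [c cP] := choice_fun cover.
pose syz X := subrmod (lkerHom_submod (proj1 (proj2 (cP X)))).
pose X n := iter n syz M.
pose P n := projT1 (c (X n)); pose p n : 'Hom(P n, X n) := projT2 (c (X n)).
have pH n : p n \in HomA (P n) (X n) by have [_ []] := cP (X n).
have pS n y : exists x, p n x = y by have [_ []] := cP (X n).
pose i n : 'Hom(X n.+1, P n) := sub_incl (lkerHom_submod (proj1 (proj2 (cP (X n))))).
have iH n : i n \in HomA (X n.+1) (P n) by apply: sub_incl_hom.
have iI n x : i n x = 0 -> x = 0 by apply: sub_incl_eq0.
have pi n x : p n (i n x) = 0 by apply/eqP; rewrite -memv_ker; apply: sub_incl_in.
have ip n x : p n x = 0 -> exists y, i n y = x.
  by move=> px; apply: sub_incl_onto; rewrite memv_ker px.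
have ex n : limg (i n \o p n.+1)%VF = lker (p n).
  apply/limg_lker; split=> [x | x /ip[y <-]]; first by rewrite comp_lfunE pi.
  by have [z <-] := pS _ y; exists z; rewrite comp_lfunE.
unshelve eexists (@ProjResolution K A M P (fun n => i n \o p n.+1)%VF (p 0%N)
  _ _ _ _ _ _).
- by move=> n; have [] := cP (X n).
- by move=> n; exact: (HomA_comp (pH n.+1) (iH n)).
- exact: pH.
- by apply/limgP=> y; apply: pS.
- exact: ex.
- move=> n; rewrite ex; apply/vspaceP=> x; rewrite !memv_ker comp_lfunE.
  by apply/eqP/eqP=> [-> | /iI //]; rewrite linear0.
- by [].
Qed.

Section Splice.
Variables (X Q L : rmodule A) (R : proj_resolution L).
Variables (k : 'Hom(L, Q)) (p : 'Hom(Q, X)).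
Hypotheses (pQ : is_projective Q) (kH : k \in HomA L Q) (pH : p \in HomA Q X).
Hypotheses (kI : forall x, k x = 0 -> x = 0) (pS : forall y, exists x, p x = y).
Hypothesis kp : limg k = lker p.

Definition splice_obj n := if n is m.+1 then R m else Q.

Definition splice_d n : 'Hom(splice_obj n.+1, splice_obj n) :=
  match n with 0 => (k \o pres_aug R)%VF | m.+1 => pres_d R m end.

Fact splice_exact0 : limg (splice_d 0) = lker p.
Proof.
have [pk kS] := proj1 (limg_lker _ _) kp; apply/limg_lker.
split=> [x | x /kS[y <-]] /=; first by rewrite comp_lfunE pk.
have [z <-] := proj1 (limgP _) (pres_aug_surj R) y.
by exists z; rewrite comp_lfunE.
Qed.

Fact splice_exact n : limg (splice_d n.+1) = lker (splice_d n).
Proof.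
case: n => [|n] /=; last exact: pres_exact.
rewrite pres_exact0; apply/vspaceP=> x; rewrite !memv_ker comp_lfunE.
by apply/eqP/eqP=> [-> | /kI //]; rewrite linear0.
Qed.

Definition splice : proj_resolution X.
Proof.
refine (@ProjResolution K A X splice_obj splice_d p _ _ pH _ splice_exact0 splice_exact).
- by case=> [|n] //; apply: (@pres_proj _ _ _ R n).
- case=> [|n] /=; [exact: HomA_comp (pres_aug_hom _) kH | exact: pres_d_hom].
- exact/limgP.
Defined.

End Splice.

Definition Ext_acyclic X N : Prop := forall i, Ext_eq0 i.+1 X N.

(** Dimension shift: a resolution of [L] continued by [Q] resolves [X].  The
    extension of maps from [L] to [Q] is what Ext^1(X, N) = 0 says. *)
Lemma Ext_acyclic_syzygy X Q L N (k : 'Hom(L, Q)) (p : 'Hom(Q, X)) :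
  is_projective Q -> k \in HomA L Q -> p \in HomA Q X ->
  (forall x, k x = 0 -> x = 0) -> (forall y, exists x, p x = y) ->
  limg k = lker p -> Ext_acyclic X N ->
  Ext_acyclic L N /\
  forall g, g \in HomA L N -> exists2 h, h \in HomA Q N & forall x, g x = h (k x).
Proof.
move=> pQ kH pH kI pS kp acX; have [R _] := proj_resolution_exists L.
pose S := splice R pQ kH pH kI pS kp; split=> [i | g gH].
  by exists R; apply/ext_vanishesP; exact: (@Ext_eq0S_vanishes _ S _ _ (acX i.+1)).
have [||h hH hE] := @Ext_eq0S_vanishes _ S _ _ (acX 0%N) ( (g \o pres_aug R)%VF).
- exact: HomA_comp (pres_aug_hom R) gH.
- by move=> x; rewrite comp_lfunE pres_d_aug linear0.
exists h => // x; have [y <-] := proj1 (limgP _) (pres_aug_surj R) x.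
by have := hE y; rewrite /= !comp_lfunE.
Qed.

Lemma Ext_acyclic_resolution M (P : proj_resolution M) N :
  (forall n, ext_vanishes P N n) -> Ext_acyclic M N.
Proof. by move=> van n; exists P; apply/ext_vanishesP. Qed.

End Ext.

(** * Reflexive modules *)

Section Reflexive.
Variables (K : fieldType) (A : falgType K).
Implicit Types (M N P Q X : rmodule A).

Definition star_elt M (l : 'Hom(M, regmod A)) (lH : l \in HomA M (regmod A)) :
  starmod M := Subvs lH.

Lemma star_hom M (g : starmod M) : vsval g \in HomA M (regmod A).
Proof. exact: subvsP. Qed.

Lemma star_ractE M (g : starmod M) (a : A) x : vsval (ract g a) x = a * vsval g x.
Proof. by rewrite /= comp_lfunE lfunE. Qed.

Lemma star_ext M (g h : starmod M) : (forall x, vsval g x = vsval h x) -> g = h.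
Proof. by move=> gh; apply: subvs_inj; apply/lfunP. Qed.

Lemma star_sumE M (I : finType) (g : I -> starmod M) x :
  vsval (\sum_i g i) x = \sum_i vsval (g i) x.
Proof. by rewrite linear_sum sum_lfunE. Qed.

Lemma star_linE M k (g h : starmod M) x :
  vsval (k *: g + h) x = k *: vsval g x + vsval h x.
Proof. by rewrite linearP add_lfunE scale_lfunE. Qed.

Fact eval_star_is_linear M (x : M) :
  linear (fun g : starmod M => vsval g x : regmod A^c).
Proof. by move=> k g h; rewrite linearP add_lfunE scale_lfunE. Qed.

Definition eval_star M (x : M) : 'Hom(starmod M, regmod A^c) :=
  mkhom (eval_star_is_linear x).

Lemma eval_starE M (x : M) g : eval_star x g = vsval g x.
Proof. exact: mkhomE. Qed.

Lemma eval_star_hom M (x : M) : eval_star x \in HomA (starmod M) (regmod A^c).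
Proof. by apply/HomAP=> g a; rewrite !eval_starE star_ractE. Qed.

Definition torsionless M : Prop :=
  forall x : M, (forall g : starmod M, vsval g x = 0) -> x = 0.

Definition reflexive M : Prop :=
  torsionless M /\
  forall F, F \in HomA (starmod M) (regmod A^c) ->
    exists x, forall g, F g = vsval g x.

Lemma star_dual_basis P n (e : 'I_n -> P) l (lH : forall i, l i \in HomA P (regmod A)) :
  dual_basis e l ->
  forall g : starmod P, g = \sum_i ract (star_elt (lH i)) (vsval g (e i) : A^c).
Proof.
move=> [_ eP] g; apply: star_ext => x; rewrite star_sumE {1}[x]eP linear_sum.
by apply: eq_bigr => i _; rewrite star_ractE /= (HomA_ract _ _ (star_hom g)).
Qed.

(** Evaluations at the [e i] form, with the [l i], a dual basis of the dual. *)
Lemma star_projective P : is_projective P -> is_projective (starmod P).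
Proof.
move=> /projective_dual_basis[n [e [l eP]]]; have [lH _] := eP.
apply: (@dual_basis_projective _ _ (starmod P) n (fun i => star_elt (lH i))
  (fun i => eval_star (e i))).
split=> [i | g]; first exact: eval_star_hom.
rewrite {1}(star_dual_basis lH eP g).
by apply: eq_bigr => i _; rewrite eval_starE.
Qed.

(** In terms of a dual basis, a map F on the dual is the evaluation at the sum of
    the e_i F(l_i). *)
Lemma projective_reflexive P : is_projective P -> reflexive P.
Proof.
move=> /projective_dual_basis[n [e [l eP]]]; have [lH eE] := eP; split=> [x x0 | F FH].
  rewrite (eE x) big1 // => i _.
  by have := x0 (star_elt (lH i)); rewrite /= => ->; rewrite ract0r.
exists (\sum_i ract (e i) (F (star_elt (lH i)) : A)) => g.
rewrite {1}(star_dual_basis lH eP g) !linear_sum; apply: eq_bigr => i _.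
rewrite -[LHS]/(F (ract (star_elt (lH i)) (vsval g (e i) : A^c))) (HomA_ract _ _ FH).
by rewrite -[RHS]/(vsval g (ract (e i) _)) (HomA_ract _ _ (star_hom g)).
Qed.

End Reflexive.

(** * The map from D(A) to A and the Nakayama functors *)

Notation dualreg A := (codualmod (regmod A^c)).

(** A symmetric bimodule map from D(A) to A, left linearity being a consequence of
    symmetry; the last two fields identify [A] with Hom_A(D(A), A).  For a
    symmetric algebra, the inverse of an isomorphism from A to D(A) is one. *)
Record canonical_map (K : fieldType) (A : falgType K)
    (c : 'Hom(dualreg A, regmod A)) : Prop :=
  CanonicalMap {
    canmap_hom : c \in HomA (dualreg A) (regmod A);
    canmap_sym : forall f g : dualreg A, f (c g) = g (c f);
    canmap_onto : forall F, F \in HomA (dualreg A) (regmod A) ->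
      exists a : A, forall f, F f = a * c f;
    canmap_inj : forall a : A, (forall f, a * c f = 0) -> a = 0
  }.

Section Canonical.
Variables (K : fieldType) (A : falgType K) (c : 'Hom(dualreg A, regmod A)).
Hypothesis canc : canonical_map c.
Implicit Types (C J M N P Q X : rmodule A).
Local Notation D V := 'Hom(V, K^o).

(** The isomorphism from D(X) to Hom_A(X, D(A)) sends [g] to [coef g]. *)
Definition coef X (g : D X) (x : X) : dualreg A := (g \o orbit_map x)%VF.

Lemma coefE X (g : D X) (x : X) a : coef g x a = g (ract x a).
Proof. by rewrite /coef comp_lfunE; congr (g _); apply: orbit_mapE. Qed.

Fact coef_is_linear X (g : D X) : linear (coef g).
Proof.
move=> k x y; apply/lfunP=> a.
by rewrite add_lfunE scale_lfunE !coefE ractDl ractZl linearP.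
Qed.

Definition coef_map X (g : D X) : 'Hom(X, dualreg A) := mkhom (coef_is_linear g).

Lemma coef_mapE X (g : D X) x : coef_map g x = coef g x.
Proof. exact: mkhomE. Qed.

Lemma coef_map_hom X (g : D X) : coef_map g \in HomA X (dualreg A).
Proof.
apply/HomAP=> x b; rewrite !coef_mapE; apply/lfunP=> a.
by rewrite codual_ractE !coefE /= ractM.
Qed.

(** [dualreg A] only records the right action on the bimodule D(A); this is the
    left one. *)
Definition lmul (a : A) (f : dualreg A) : dualreg A :=
  @ract _ _ (dualmod (regmod A)) f a.

Lemma lmulE (a : A) f (x : A) : lmul a f x = f (x * a).
Proof. exact: (@dual_ractE _ _ (regmod A) f a x). Qed.

Lemma canmap_right f (a : A) : c (ract f a) = c f * a.
Proof. exact: (HomA_ract _ _ (canmap_hom canc)). Qed.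

Lemma dualreg_ractE (f : dualreg A) (a x : A) : (ract f a : D A) x = f (a * x).
Proof. exact: (@codual_ractE _ _ (regmod A^c) f a x). Qed.

(** Symmetry moves the left action to the right action on the other argument. *)
Lemma canmap_left (a : A) (f : dualreg A) : c (lmul a f) = a * c f.
Proof.
apply: functional_ext => g; rewrite (canmap_sym canc) lmulE -canmap_right.
by rewrite (canmap_sym canc) dualreg_ractE.
Qed.

(** The map from [X] to its image Hom_A(D(A), X) under the inverse Nakayama functor,
    induced by [c], is bijective. *)
Definition conakayama X : Prop :=
  (forall h, h \in HomA (dualreg A) X ->
     exists x : X, forall f, h f = ract x (c f : A)) /\
  (forall x : X, (forall f, ract x (c f : A) = 0) -> x = 0).

(** For h : D(A) -> X and g : X -> A, the composite g h is F(g) c(-) for a unique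
    element F(g) of [A].  The map F on the dual of [X] is linear over [A], so it is
    the evaluation at some x, and h is x c(-). *)
Lemma reflexive_conakayama X : reflexive X -> conakayama X.
Proof.
move=> [tX rX]; split=> [h hH | x x0]; last first.
  apply: tX => g; apply: (canmap_inj canc) => f.
  by rewrite -[_ * _](HomA_ract _ _ (star_hom g)) x0 linear0.
have [F FE] : exists F : 'Hom(starmod X, A),
    forall (g : starmod X) f, vsval g (h f) = F g * c f :> A.
  apply: (lfun_of_rel (R := fun (g : starmod X) a =>
    forall f, vsval g (h f) = a * c f :> A))
    => [g | g a b aE bE | k g g' a b aE bE f].
  - have [a aE] := canmap_onto canc (HomA_comp hH (star_hom g)).
    by exists a => f; rewrite -aE comp_lfunE.
  - apply/eqP; rewrite -subr_eq0; apply/eqP/(canmap_inj canc) => f.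
    by rewrite mulrBl -aE -bE subrr.
  - by rewrite linearP add_lfunE scale_lfunE aE bE mulrDl scalerAl.
have FH : (F : 'Hom(starmod X, regmod A^c)) \in HomA (starmod X) (regmod A^c).
  apply/HomAP=> g b; apply/eqP; rewrite -subr_eq0; apply/eqP/(canmap_inj canc) => f.
  rewrite mulrBl -FE star_ractE FE.
  by rewrite -[@ract _ _ (regmod A^c) (F g) b]/((b : A) * (F g : A)) mulrA subrr.
have [x xE] := rX _ FH; exists x => f; apply/eqP; rewrite -subr_eq0; apply/eqP.
apply: tX => g; rewrite linearB /= FE xE (HomA_ract _ _ (star_hom g)).
exact: subrr.
Qed.

(** Five lemma: the lifting hypothesis makes Hom_A(D(A), -) exact on
    0 -> X -> J -> C -> 0. *)
Lemma conakayama_quotient X J C (i : 'Hom(X, J)) (p : 'Hom(J, C)) :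
  i \in HomA X J -> p \in HomA J C -> (forall x, i x = 0 -> x = 0) ->
  limg i = lker p -> (forall y, exists x, p x = y) ->
  (forall h, h \in HomA (dualreg A) C ->
     exists2 k, k \in HomA (dualreg A) J & forall f, h f = p (k f)) ->
  conakayama X -> conakayama J -> conakayama C.
Proof.
move=> iH pH iI /limg_lker[pi ip] pS lift [onX injX] [onJ injJ].
split=> [h /lift[k kH kE] | u u0].
  by have [j jE] := onJ k kH; exists (p j) => f; rewrite kE jE (HomA_ract _ _ pH).
have [j ju] := pS u.
have iuniq := ker0_inj iI.
have [h hE] : exists h : 'Hom(dualreg A, X), forall f, i (h f) = ract j (c f : A).
  apply: (lfun_of_rel (R := fun f x => i x = ract j (c f : A)))
    => [f | f x y xE yE | k f g x y xE yE].
  - by apply: ip; rewrite (HomA_ract _ _ pH) ju u0.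
  - by apply: iuniq; rewrite xE yE.
  - by rewrite !linearP /= xE yE ractDr ractZr.
have hH : h \in HomA (dualreg A) X.
  apply/HomAP=> f a; apply: iuniq.
  by rewrite (HomA_ract _ _ iH) !hE canmap_right ractM.
have [x xE] := onX h hH.
suff jx : j - i x = 0 by rewrite -ju -[j](subrK (i x)) jx add0r pi.
by apply: injJ => f; rewrite ractBl -(HomA_ract _ _ iH) -xE hE subrr.
Qed.

(** The coefficients of [X] along a basis of D(X), followed by [c], embed [X] in a
    power of [A]: by symmetry, c(coef g x) = 0 for all g means that
    g(x c(f)) = 0 for all g and f. *)
Lemma conakayama_embeds X J (j : 'Hom(regmod A, J)) :
  is_projective J -> is_injective J -> j \in HomA (regmod A) J ->
  (forall a, j a = 0 -> a = 0) -> conakayama X ->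
  exists Q, [/\ is_projective Q, is_injective Q &
    exists2 i, i \in HomA X Q & forall x, i x = 0 -> x = 0].
Proof.
move=> pJ iJ jH jI [_ injX]; pose e := vbasis {:D X}.
exists (powmod J (\dim {:D X})).
split; [exact: pow_projective | exact: pow_injective |].
have [i iH iE] := pow_pair (fun k : 'I_(\dim {:D X}) =>
  HomA_comp (HomA_comp (coef_map_hom (e`_k)) (canmap_hom canc)) jH).
exists i => // x ix; apply: injX => f; apply: separate_point => g.
rewrite -(coefE g) -(canmap_sym canc); apply: etrans (linear0 _); congr (f _).
rewrite (coord_vbasis (memvf g)).
have -> : coef (\sum_(k < \dim {:D X}) coord e k g *: e`_k) x =
    \sum_(k < \dim {:D X}) coord e k g *: coef e`_k x.
  apply/lfunP=> a; rewrite coefE !sum_lfunE; apply: eq_bigr => k _.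
  by rewrite !scale_lfunE coefE.
rewrite linear_sum big1 // => k _; rewrite linearZ /=.
apply/eqP; rewrite scaler_eq0; apply/orP; right.
apply/eqP/jI; have := iE k x; rewrite ix linear0 !comp_lfunE coef_mapE.
by move=> <-.
Qed.

(** The map from D(Q) to Hom_A(Q, A) induced by [c] is bijective; dually, [Q] is its
    own image under the Nakayama functor D Hom_A(-, A). *)
Definition nakayama Q : Prop :=
  (forall f, f \in HomA Q (regmod A) -> exists g : D Q, forall q, f q = c (coef g q)) /\
  (forall g : D Q, (forall q, c (coef g q) = 0) -> g = 0).

(** The coefficients along a basis of D(Q) embed [Q] in a power of D(A), and the
    embedding splits. *)
Lemma injective_cobasis Q : is_injective Q ->
  exists n (i : 'I_n -> 'Hom(Q, dualreg A)) (r : 'I_n -> 'Hom(dualreg A, Q)),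
    [/\ forall k, i k \in HomA Q (dualreg A), forall k, r k \in HomA (dualreg A) Q &
        forall q, q = \sum_k r k (i k q)].
Proof.
move=> iQ; pose e := vbasis {:D Q}; pose n := \dim {:D Q}.
have [i iH iE] := pow_pair (fun k : 'I_n => coef_map_hom (e`_k)).
have iI q : i q = 0 -> q = 0.
  move=> iq; apply: separate_point => g; rewrite (coord_vbasis (memvf g)).
  rewrite sum_lfunE big1 // => k _; rewrite scale_lfunE.
  have := iE k q; rewrite iq linear0 coef_mapE => /(congr1 (fun u : D A => u 1)).
  by rewrite zero_lfunE coefE ract1 => <-; rewrite scaler0.
have [r rH rE] := inj_retract iQ iH iI.
exists n, (fun k => coef_map (e`_k)), (fun k => r \o pow_inj _ k)%VF.
split=> [k | k | q]; first exact: coef_map_hom.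
  by apply: HomA_comp rH; apply: pow_inj_hom.
rewrite -{1}[q]rE [i q]pow_decomp linear_sum; apply: eq_bigr => k _.
by rewrite iE comp_lfunE.
Qed.

(** By retraction to Q = D(A), where D(Q) = A and the claim is that [A] is
    Hom_A(D(A), A). *)
Lemma injective_nakayama Q : is_injective Q -> nakayama Q.
Proof.
move=> /injective_cobasis[n [i [r [iH rH irE]]]]; split=> [f fH | g g0].
  have [a aE] := choice_fun (fun k => canmap_onto canc (HomA_comp (rH k) fH)).
  have lg : linear (fun q => \sum_k (i k q : D A) (a k) : K^o).
    move=> k x y; rewrite scaler_sumr -big_split /=; apply: eq_bigr => l _.
    by rewrite linearP add_lfunE scale_lfunE.
  exists (mkhom lg) => q; rewrite {1}[q]irE linear_sum.
  have -> : coef (mkhom lg) q = \sum_k lmul (a k) (i k q).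
    apply/lfunP=> b; rewrite coefE mkhomE sum_lfunE; apply: eq_bigr => k _.
    by rewrite lmulE (HomA_ract _ _ (iH k)) dualreg_ractE.
  rewrite linear_sum; apply: eq_bigr => k _ /=.
  by rewrite canmap_left -aE comp_lfunE.
have gr k : (g \o r k)%VF = 0.
  have [a aE] := functional_eval (g \o r k)%VF.
  have a0 : a = 0.
    apply: (canmap_inj canc) => f; rewrite -canmap_left -(g0 (r k f)); congr (c _).
    apply/lfunP=> b; rewrite lmulE coefE -(HomA_ract _ _ (rH k)) -comp_lfunE aE.
    by rewrite dualreg_ractE.
  by apply/lfunP=> f; rewrite aE a0 linear0 zero_lfunE.
apply/lfunP=> q; rewrite [q]irE linear_sum zero_lfunE big1 // => k _ /=.
by rewrite -comp_lfunE gr zero_lfunE.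
Qed.

End Canonical.

(** * Injective hulls *)

Section Hull.
Variables (K : fieldType) (A : falgType K).
Implicit Types (J Q X : rmodule A).

(** Among the endomorphisms of [J] that fix [X], take h of minimal rank.  Then h h
    has the same rank, so the image of h is a retract of [J].  Were W a nonzero
    submodule of the image meeting [X] trivially, then, [J] being injective, some
    endomorphism k would fix [X] and kill W, and k h would have smaller rank. *)
Lemma injective_hull J X (i : 'Hom(X, J)) :
  is_projective J -> is_injective J -> i \in HomA X J ->
  (forall x, i x = 0 -> x = 0) ->
  exists Q (j : 'Hom(X, Q)), [/\ is_projective Q, is_injective Q, j \in HomA X Q,
    forall x, j x = 0 -> x = 0 & essential (limg j)].
Proof.
move=> pJ iJ iH iI.
suff hull n (h : 'Hom(J, J)) : (\dim (limg h) < n)%N -> h \in HomA J J ->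
    (forall x, h (i x) = i x) ->
  exists Q (j : 'Hom(X, Q)), [/\ is_projective Q, is_injective Q, j \in HomA X Q,
    forall x, j x = 0 -> x = 0 & essential (limg j)].
  by apply: (hull _ \1%VF (ltnSn _)) => [|x]; rewrite ?HomA_id ?id_lfunE.
elim: n h => [//|n IHn] h hn hH hi.
have smaller (k : 'Hom(J, J)) : k \in HomA J J -> (forall x, k (i x) = i x) ->
    (limg h :&: lker k != 0)%VS ->
  exists Q (j : 'Hom(X, Q)), [/\ is_projective Q, is_injective Q, j \in HomA X Q,
    forall x, j x = 0 -> x = 0 & essential (limg j)].
  move=> kH ki hk; apply: (IHn (k \o h)%VF).
  - rewrite limg_comp -ltnS; apply: leq_trans hn; rewrite ltnS.
    rewrite -(limg_ker_dim k (limg h)) -{1}[\dim (_ @: _)]add0n.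
    by rewrite ltn_add2r lt0n dimv_eq0.
  - exact: HomA_comp.
  - by move=> x; rewrite comp_lfunE hi ki.
have [hh | /smaller] := eqVneq (limg h :&: lker h)%VS 0%VS; last by apply.
have sQ := limgHom_submod hH; pose Q := subrmod sQ; pose e := sub_incl sQ.
have eH : e \in HomA Q J := sub_incl_hom sQ.
have [h' h'H h'E] : exists2 h', h' \in HomA J Q & forall x, h x = e (h' x).
  by apply: sub_corestrict => // x; rewrite memv_img ?memvf.
have [j jH jE] : exists2 j, j \in HomA X Q & forall x, i x = e (j x).
  by apply: sub_corestrict => // x; rewrite -hi memv_img ?memvf.
have eI : forall u, e u = 0 -> u = 0 := @sub_incl_eq0 _ _ _ _ sQ.
have hI u : h' (e u) = 0 -> u = 0.
  move=> hu; apply: eI; apply/eqP; rewrite -memv0 -hh memv_cap sub_incl_in.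
  by rewrite memv_ker h'E hu linear0 eqxx.
have hS u : exists v, (h' \o e)%VF v = u.
  have : limg (h' \o e)%VF = fullv.
    apply/eqP; rewrite eqEdim subvf /=.
    have := limg_ker_dim (h' \o e)%VF fullv.
    rewrite (proj2 (lker0_eq0 _)) ?capv0 ?dimv0 ?add0n => [->|x] //.
    by rewrite comp_lfunE; apply: hI.
  by move/limgP.
(* the image of h is a retract: the inverse of h on its image, after h *)
have ext_id u : (h' \o e)%VF u = 0 -> (\1 : 'End(Q))%VF u = 0.
  by rewrite comp_lfunE id_lfunE; apply: hI.
have [t tH tE] := hom_factor (HomA_id Q) (HomA_comp eH h'H) hS ext_id.
have retrQ : retract_of Q J.
  exists e, (t \o h')%VF; split=> // [|u]; first exact: HomA_comp.
  by have := tE u; rewrite !comp_lfunE id_lfunE.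
have jI x : j x = 0 -> x = 0 by move=> jx; apply: iI; rewrite jE jx linear0.
have [ess|] := classic (essential (limg j)).
  exists Q, j; split=> //; first exact: retract_projective retrQ pJ.
  exact: retract_injective retrQ iJ.
move=> /not_all_ex_not[W nW]; have [sW nW'] := imply_to_and _ _ nW.
have [Wj /eqP Wn0] := imply_to_and _ _ nW'.
(* an endomorphism of J fixing X and killing W: extend i along X -> J / W *)
have sW' : is_submod (e @: W)%VS.
  move=> _ a /memv_imgP[u uW ->]; rewrite -(HomA_ract _ _ eH) memv_img //.
  exact: sW.
have qiI x : (quot_map sW' \o i)%VF x = 0 -> x = 0.
  rewrite comp_lfunE => /quot_map_eq0/memv_imgP[u uW iu]; apply: jI.
  have uj : u = j x by apply: (ker0_inj eI); rewrite -jE iu.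
  by apply/eqP; rewrite -memv0 -Wj memv_cap -uj uW uj memv_img ?memvf.
have [k kH kE] := inj_extend iJ (HomA_comp iH (quot_map_hom sW')) qiI iH.
apply: (smaller (k \o quot_map sW')%VF).
- exact: HomA_comp (quot_map_hom _) kH.
- by move=> x; have := kE x; rewrite !comp_lfunE => <-.
apply: contraNneq Wn0 => hk0; rewrite -subv0; apply/subvP=> u uW.
rewrite memv0; apply/eqP/eI/eqP.
rewrite -memv0 -hk0 memv_cap sub_incl_in memv_ker comp_lfunE.
by rewrite (proj2 (quot_map_eq0 sW' (e u))) ?linear0 ?eqxx ?memv_img.
Qed.

End Hull.

(** * Passage to the opposite algebra *)

(** What the proof retains of a gendo-symmetric algebra: in contrast with a
    presentation as an endomorphism algebra, it passes to the opposite algebra by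
    plain transposition. *)
Definition dualizing_data (K : fieldType) (A : falgType K) : Prop :=
  (exists c : 'Hom(dualreg A, regmod A), canonical_map c) /\
  (exists (J : rmodule A) (j : 'Hom(regmod A, J)), [/\ is_projective J, is_injective J,
     j \in HomA (regmod A) J & forall a, j a = 0 -> a = 0]).

Section Opposite.
Variables (K : fieldType) (A : falgType K).
Local Notation D V := 'Hom(V, K^o).

(** The transpose of a left linear F : D(A) -> A is right linear, hence of the form
    b c(-); by symmetry F is then c(-) b. *)
Lemma canonical_map_op (c : 'Hom(dualreg A, regmod A)) :
  canonical_map c -> @canonical_map K A^c (c : 'Hom(dualreg A^c, regmod A^c)).
Proof.
move=> canc; split.
- by apply/HomAP=> f a; apply: (canmap_left canc).
- exact: (canmap_sym canc).
- move=> F FH; have [g gE] := untranspose (F : 'Hom(D A, A)).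
  have FE (a : A) (f : dualreg A) : F (lmul a f) = a * F f :> A.
    exact: (HomA_ract _ _ FH).
  have gH : (g : 'Hom(dualreg A, regmod A)) \in HomA (dualreg A) (regmod A).
    apply/HomAP=> h a; apply: functional_ext => l.
    rewrite gE dualreg_ractE -FE -gE.
    exact: lmulE.
  have [b bE] := canmap_onto canc gH; exists b => f; apply: functional_ext => h.
  rewrite -[h (F f)]gE bE -[LHS]/((f : D A) ((b : A) * c h : A)) -dualreg_ractE.
  by rewrite (canmap_sym canc) (canmap_right canc).
- move=> a a0; apply: (canmap_inj canc) => g; apply: functional_ext => f.
  rewrite -dualreg_ractE (canmap_sym canc) (canmap_right canc).
  by rewrite -[c f * a]/((a : A^c) * c f) a0 !linear0.
Qed.

(** [J] is faithful because it contains [A]; hence [A] embeds, as a left module, in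
    a power of D(J). *)
Lemma dualizing_data_op : dualizing_data A -> dualizing_data A^c.
Proof.
move=> [[c canc] [J [j [pJ iJ jH jI]]]].
split; first by exists c; apply: canonical_map_op.
pose e := vbasis {:D J}.
have oH (k : 'I_(\dim {:D J})) :
    (@orbit_map _ _ (dualmod J) (e`_k) : 'Hom(regmod A^c, dualmod J))
      \in HomA (regmod A^c) (dualmod J).
  by apply/HomAP=> x a; rewrite !orbit_mapE; apply: (@ractM _ _ (dualmod J)).
have [i iH iE] := pow_pair oH.
exists (powmod (dualmod J) (\dim {:D J})), i; split=> //.
- exact/pow_projective/dual_projective.
- exact/pow_injective/dual_injective.
move=> a ia; apply: jI.
have -> : j a = ract (j (1 : A)) (a : A) by rewrite -(HomA_ract _ _ jH) /= mul1r.
apply: separate_point => g; rewrite (coord_vbasis (memvf g)) sum_lfunE big1 // => k _.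
rewrite scale_lfunE -[X in _ *: X]/((e`_k : D J) (ract (j (1 : A)) (a : A))).
have := iE k a; rewrite ia linear0 orbit_mapE.
move=> /(congr1 (fun u : D J => u (j (1 : A)))).
by rewrite zero_lfunE dual_ractE => <-; rewrite scaler0.
Qed.

End Opposite.

Lemma HomA_upI (K : fieldType) (A : falgType K) (M N : rmodule A) (f : 'Hom(M, N)) :
  f \in HomA M N -> f \in HomA (upmod M) (upmod N).
Proof. by rewrite HomA_up. Qed.

Section Transport.
Variables (K : fieldType) (A : falgType K) (M : rmodule A).
Local Notation DDM := (dualmod (dualmod M)).

Let e : 'Hom(M, DDM) := eval_map M.

Lemma eval_up_hom : e \in HomA (upmod M) DDM.
Proof. by rewrite HomA_up_down; apply: eval_map_hom. Qed.

(** The bidual of [M], over [(A^c)^c], is [M] itself up to evaluation. *)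
Lemma Ext_acyclic_bidual :
  Ext_acyclic M (regmod A) -> Ext_acyclic DDM (regmod (A^c)^c).
Proof.
move=> acM; have [P _] := proj_resolution_exists M.
have aH : (e \o pres_aug P)%VF \in HomA (upmod (P 0%N)) DDM.
  apply: (HomA_comp (N := upmod M)) eval_up_hom.
  exact: (HomA_upI (pres_aug_hom P)).
have aS : limg (e \o pres_aug P)%VF = fullv.
  apply/limgP=> y; have [x <-] := eval_map_onto y.
  have [z <-] := proj1 (limgP _) (pres_aug_surj P) x.
  by exists z; rewrite comp_lfunE.
have ex0 : limg (pres_d P 0) = lker (e \o pres_aug P)%VF.
  rewrite (pres_exact0 P); apply/vspaceP=> x; rewrite !memv_ker comp_lfunE.
  by apply/eqP/eqP=> [-> | /eval_map_eq0//]; rewrite linear0.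
pose Q := @ProjResolution K (A^c)^c DDM (fun n => upmod (P n)) (pres_d P) _
  (fun n => up_projective (@pres_proj _ _ _ P n))
  (fun n => HomA_upI (pres_d_hom P n)) aH aS ex0 (pres_exact P).
apply: (Ext_acyclic_resolution (P := Q)) => n f fH fd.
have fH' : f \in HomA (P n.+1) (regmod A) by move: fH => /HomAP fH; apply/HomAP.
have [h hH hE] := @Ext_eq0S_vanishes _ _ _ P _ _ (acM n) f fH' fd.
by exists h => //; move: hH => /HomAP hH; apply/HomAP.
Qed.

Lemma domdim_bidual : domdim M None -> domdim DDM None.
Proof.
move=> [I pI].
have [e' e'E] : exists e' : 'Hom(DDM, M), forall y, e (e' y) = y.
  apply: (lfun_of_rel (R := fun y x => e x = y))
    => [y | y x x' <- /esym exx' | k y y' x x' <- <-].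
  - exact: eval_map_onto.
  - by apply: (ker0_inj (@eval_map_eq0 _ _ M)); rewrite -/e exx'.
  - by rewrite linearP.
have ee' x : e' (e x) = x.
  by apply: (ker0_inj (@eval_map_eq0 _ _ M)); apply: e'E.
have e'H : e' \in HomA DDM (upmod M).
  by apply/HomAP=> y a; rewrite -{1}[y]e'E -(HomA_ract _ _ eval_up_hom) ee'.
have aH : (ires_aug I \o e')%VF \in HomA DDM (upmod (I 0%N)).
  by apply: HomA_comp e'H _; apply: (HomA_upI (ires_aug_hom I)).
have aI : (lker (ires_aug I \o e') = 0)%VS.
  apply/lker0_eq0=> y; rewrite comp_lfunE => /(proj1 (lker0_eq0 _) (ires_aug_inj I)).
  by move=> y0; rewrite -[y]e'E y0 linear0.
have aE : limg (ires_aug I \o e')%VF = limg (ires_aug I).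
  apply/vspaceP=> x; apply/memv_imgP/memv_imgP=> -[y _ ->].
    by exists (e' y); rewrite ?memvf ?comp_lfunE.
  by exists (e y); rewrite ?memvf // comp_lfunE ee'.
have ess n (U : {vspace I n}) : essential U -> @essential _ _ (upmod (I n)) U.
  by move=> essU W sW; apply: essU.
exists (@MinInjCoresolution K (A^c)^c DDM (fun n => upmod (I n)) (ires_d I)
  (ires_aug I \o e')%VF
  (fun n => up_injective (@ires_inj _ _ _ I n))
  (fun n => HomA_upI (ires_d_hom I n)) aH aI (etrans aE (ires_exact0 I)) (ires_exact I)
  (ess 0%N _ (eq_ind_r (fun U => essential U) (@ires_min0 _ _ _ I) aE))
  (fun n => ess n.+1 _ (@ires_min _ _ _ I n))) => n.
exact: up_projective (pI n).
Qed.

End Transport.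

(** * Infinite dominant and codominant dimension give Gorenstein projectivity *)

Lemma splice_injective (K : fieldType) (A : falgType K) (X Q L : rmodule A)
    (R : proj_resolution L)
    (k : 'Hom(L, Q)) (p : 'Hom(Q, X)) :
  is_projective Q -> is_injective Q -> k \in HomA L Q -> p \in HomA Q X ->
  (forall x, k x = 0 -> x = 0) -> (forall y, exists x, p x = y) ->
  limg k = lker p -> (forall n, is_injective (R n)) ->
  exists S : proj_resolution X, forall n, is_injective (S n).
Proof.
move=> pQ iQ kH pH kI pS kp iR.
by exists (splice R pQ kH pH kI pS kp) => -[|n]; [exact: iQ | exact: iR].
Qed.

Section InjectiveResolutions.
Variables (K : fieldType) (A : falgType K) (c : 'Hom(dualreg A, regmod A)).
Hypothesis canc : canonical_map c.
Local Notation D V := 'Hom(V, K^o).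

Lemma coef_map_tr (X Y : rmodule A) (f : 'Hom(X, Y)) (g : D Y) x :
  f \in HomA X Y -> coef (tr f g) x = coef g (f x).
Proof. by move=> fH; apply/lfunP=> a; rewrite !coefE trE (HomA_ract _ _ fH). Qed.

Lemma coef_ract (X : rmodule A) (g : D X) x (a : A) :
  coef (ract (g : dualmod X) a) x = lmul a (coef g x).
Proof.
by apply/lfunP=> b; rewrite coefE dual_ractE lmulE coefE -ractM.
Qed.

(** On injective modules [c] identifies Hom_A(-, A) with the exact functor D. *)
Lemma injective_resolution_acyclic (M : rmodule A) (P : proj_resolution M) :
  (forall n, is_injective (P n)) -> Ext_acyclic M (regmod A).
Proof.
move=> iP; apply: (Ext_acyclic_resolution (P := P)) => n f fH fd.
have [onP _] := injective_nakayama canc (iP n.+1).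
have [_ injP] := injective_nakayama canc (iP n.+2).
have [g gE] := onP f fH.
have gd : tr (pres_d P n.+1) g = 0.
  by apply: injP => x; rewrite coef_map_tr ?pres_d_hom // -gE.
have [x dx | h hE] := @lfun_factor K _ _ K^o g (pres_d P n).
  have [_ /(_ x dx)[y <-]] := proj1 (limg_lker _ _) (pres_exact P n).
  by rewrite -trE gd zero_lfunE.
exists (c \o coef_map h)%VF; first exact: HomA_comp (coef_map_hom h) (canmap_hom canc).
move=> x; rewrite gE comp_lfunE coef_mapE -coef_map_tr ?pres_d_hom //.
by congr (c (coef _ _)); apply/lfunP=> y; rewrite trE hE.
Qed.

Lemma nakayama_inj (P : rmodule A) (g h : D P) :
  is_injective P -> (forall q, c (coef g q) = c (coef h q)) -> g = h.
Proof.
move=> /(injective_nakayama canc)[_ injP] gh.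
apply/eqP; rewrite -subr_eq0; apply/eqP/injP => q.
have -> : coef (g - h) q = coef g q - coef h q.
  by apply/lfunP=> a; rewrite add_lfunE opp_lfunE !coefE add_lfunE opp_lfunE.
by rewrite linearB /= gh subrr.
Qed.

(** The identification of Hom_A(P, A) with D(P), as left modules. *)
Lemma injective_star (P : rmodule A) : is_injective P ->
  exists2 k, k \in HomA (starmod P) (dualmod P) &
    (forall (f : starmod P) q, vsval f q = c (coef (k f : D P) q)) /\
    forall g : D P, exists f, k f = g.
Proof.
move=> iP; have [onP _] := injective_nakayama canc iP.
have injD g h := @nakayama_inj P g h iP.
have [k kE] : exists k : 'Hom(starmod P, D P),
    forall (f : starmod P) q, vsval f q = c (coef (k f) q).
  apply: (lfun_of_rel (R := fun (f : starmod P) g =>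
    forall q, vsval f q = c (coef g q)))
    => [f | f g h gE hE | l f f' g g' gE g'E q].
  - exact: onP (star_hom f).
  - by apply: injD => q; rewrite -gE hE.
  - rewrite linearP add_lfunE scale_lfunE gE g'E -linearP; congr (c _).
    by apply/lfunP=> a; rewrite add_lfunE scale_lfunE !coefE add_lfunE scale_lfunE.
exists k; [apply/HomAP=> f a | split=> // g].
  by apply: injD => q; rewrite coef_ract (canmap_left canc) -!kE star_ractE.
exists (star_elt (HomA_comp (coef_map_hom g) (canmap_hom canc))).
by apply: injD => q; rewrite -kE /= comp_lfunE coef_mapE.
Qed.

(** Since Hom_A(-, A) is D on the terms of [P], the transpose is the cokernel of
    D(P_0) -> D(P_1), which is the image of D(P_1) -> D(P_2). *)
Lemma resolution_transpose (M : rmodule A) (P : proj_resolution M) :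
  (forall n, is_injective (P n)) ->
  exists (T : rmodule A^c) (p : 'Hom(dualmod (P 1), T)), [/\ is_transpose M T,
    p \in HomA (dualmod (P 1)) T, forall y, exists x, p x = y &
    limg (tr (pres_d P 0)) = lker p].
Proof.
move=> iP.
have sT := limgHom_submod (tr_dual (pres_d_hom P 1)).
have [p pH pE] : exists2 p, p \in HomA (dualmod (P 1)) (subrmod sT) &
    forall x, tr (pres_d P 1) x = sub_incl sT (p x).
  by apply: (sub_corestrict sT (tr_dual (pres_d_hom P 1))) => x; rewrite memv_img ?memvf.
have pI x : p x = 0 <-> tr (pres_d P 1) x = 0.
  by rewrite pE; split=> [-> | /(@sub_incl_eq0 _ _ _ _ sT)//]; rewrite linear0.
have pS y : exists x, p x = y.
  have /memv_imgP[x _ xE] := sub_incl_in y; exists x.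
  by apply: (ker0_inj (@sub_incl_eq0 _ _ _ _ sT)); rewrite -pE -xE.
have trex := tr_exact (pres_exact P 0).
have ex : limg (tr (pres_d P 0)) = lker p.
  by rewrite trex; apply/vspaceP=> x; rewrite !memv_ker; apply/eqP/eqP=> /pI.
exists (subrmod sT), p; split=> //.
have [k1 k1H [k1E k1S]] := injective_star (iP 1%N).
have [k0 k0H [k0E k0S]] := injective_star (iP 0%N).
exists (P 0%N), (P 1%N), (pres_aug P), (pres_d P 0), (p \o k1)%VF.
split; split.
- split; [exact: (@pres_proj _ _ _ P 0%N) | exact: (@pres_proj _ _ _ P 1%N) | |].
    exact: pres_aug_hom.
  exact: pres_d_hom.
- exact: pres_aug_surj.
- exact: pres_exact0.
- exact: HomA_comp.
- apply/limgP=> y; have [x <-] := pS y; have [f <-] := k1S x.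
  by exists f; rewrite comp_lfunE.
move=> f; rewrite comp_lfunE pI; split=> [k1f | [g fE]].
  have /limg_lker[_ /(_ _ k1f)[h hE]] := trex; have [g gE] := k0S h.
  exists g; apply/lfunP=> x; rewrite /precomp comp_lfunE k1E k0E gE.
  by rewrite -coef_map_tr ?pres_d_hom // hE.
have -> : k1 f = tr (pres_d P 0) (k0 g).
  apply: (nakayama_inj (iP 1%N)) => x; rewrite coef_map_tr ?pres_d_hom // -k1E -k0E fE.
  by rewrite /precomp comp_lfunE.
by have /limg_lker[-> _] := trex.
Qed.

End InjectiveResolutions.

Section InfiniteDimensions.
Variables (K : fieldType) (A : falgType K).
Hypothesis dA : dualizing_data A.

Lemma dual_resolution (M : rmodule A) (I : min_inj_coresolution M) :
  (forall n, is_projective (I n)) ->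
  exists R : proj_resolution (dualmod M), forall n, is_injective (R n).
Proof.
move=> pI.
exists (@ProjResolution K A^c (dualmod M) (fun n => dualmod (I n))
  (fun n => tr (ires_d I n))
  (tr (ires_aug I)) (fun n => dual_projective (@ires_inj _ _ _ I n))
  (fun n => tr_dual (ires_d_hom I n)) (tr_dual (ires_aug_hom I)) (tr_surj (ires_aug_inj I))
  (tr_exact (ires_exact0 I)) (fun n => tr_exact (ires_exact I n))) => n.
exact: dual_injective (pI n).
Qed.

Lemma codual_resolution (M : rmodule A) (I : min_inj_coresolution (dualmod M)) :
  (forall n, is_projective (I n)) ->
  exists P : proj_resolution M, forall n, is_injective (P n).
Proof.
move=> pI; have [g gH gE] := untranspose_dual (ires_aug_hom I).
have g0 h : g h = 0 <-> tr (ires_aug I) h = 0.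
  split=> [gh | th]; [apply/lfunP=> l | apply: separate_point => l].
    by rewrite trE -gE gh linear0 zero_lfunE.
  by rewrite gE -trE th zero_lfunE.
have gS : limg g = fullv.
  apply/limgP=> y.
  have [x /(proj1 (lker0_eq0 _) (ires_aug_inj I)) -> | h hE] :=
    @lfun_factor K _ _ K^o (eval_map M y) (ires_aug I); first by rewrite linear0.
  by exists h; apply: functional_ext => l; rewrite gE -hE eval_mapE.
have ex0 : limg (tr (ires_d I 0)) = lker g.
  rewrite (tr_exact (ires_exact0 I)); apply/vspaceP=> h; rewrite !memv_ker.
  by apply/eqP/eqP=> /g0.
exists (@ProjResolution K A M (fun n => codualmod (I n)) (fun n => tr (ires_d I n))
  g (fun n => codual_projective (@ires_inj _ _ _ I n))
  (fun n => tr_codual (ires_d_hom I n)) gH gS ex0 (fun n => tr_exact (ires_exact I n))) => n.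
exact: codual_injective (pI n).
Qed.

(** With P a resolution of [M] and I a coresolution, both by projective and
    injective modules, the transpose T is resolved by
    ... -> D(I_1) -> D(I_0) -> D(P_0) -> D(P_1) -> T -> 0,
    whose terms are again projective and injective. *)
Lemma infinite_dimensions_Gorenstein_projective (M : rmodule A) :
  domdim M None -> codomdim M None -> Gorenstein_projective M.
Proof.
move=> [I /dual_resolution[R iR]] [I' /codual_resolution[P iP]].
have [[c canc] _] := dA; have [T [p [trT pH pS ex]]] := resolution_transpose canc iP.
exists T => //.
have acM := injective_resolution_acyclic canc iP.
(* it remains to resolve T; the two short exact sequences are those through
   X, the image of D(P_0) -> D(P_1) *)
suff [S iS] : exists S : proj_resolution T, forall n, is_injective (S n).
  have acT := injective_resolution_acyclic (canonical_map_op canc) iS.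
  move=> [//|i] _; split; first exact: acM.
  exact: acT.
have dP n : is_projective (dualmod (P n)) := dual_projective (iP n).
have dI n : is_injective (dualmod (P n)) := dual_injective (@pres_proj _ _ _ P n).
have sX := limgHom_submod (tr_dual (pres_d_hom P 0)).
have [p0 p0H p0E] : exists2 p0, p0 \in HomA (dualmod (P 0)) (subrmod sX) &
    forall x, tr (pres_d P 0) x = sub_incl sX (p0 x).
  by apply: (sub_corestrict sX (tr_dual (pres_d_hom P 0))) => x; rewrite memv_img ?memvf.
have p0S y : exists x, p0 x = y.
  have /memv_imgP[x _ xE] := sub_incl_in y; exists x.
  by apply: (ker0_inj (@sub_incl_eq0 _ _ _ _ sX)); rewrite -p0E -xE.
have ex0 : limg (tr (pres_aug P)) = lker p0.
  rewrite (tr_exact (pres_exact0 P)); apply/vspaceP=> x; rewrite !memv_ker p0E.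
  by apply/eqP/eqP=> [/(@sub_incl_eq0 _ _ _ _ sX)// | ->]; rewrite linear0.
have [S iS] : exists S : proj_resolution (subrmod sX), forall n, is_injective (S n).
  apply: (splice_injective (dP 0%N) (dI 0%N) (tr_dual (pres_aug_hom P)) p0H _ p0S ex0 iR).
  exact/lker0_eq0/tr_inj/pres_aug_surj.
apply: (splice_injective (dP 1%N) (dI 1%N) (sub_incl_hom sX) pH _ pS _ iS).
  exact: (@sub_incl_eq0 _ _ _ _ sX).
by rewrite limg_sub_incl.
Qed.

End InfiniteDimensions.

(** * Gorenstein-projective modules and dominant dimension *)

Section GorensteinReflexive.
Variables (K : fieldType) (A : falgType K).

Lemma star_map (X Y : rmodule A) (f : 'Hom(X, Y)) : f \in HomA X Y ->
  exists2 s, s \in HomA (starmod Y) (starmod X) &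
    forall (g : starmod Y) x, vsval (s g) x = vsval g (f x).
Proof.
move=> fH.
have ls : linear (fun g : starmod Y => star_elt (HomA_comp fH (star_hom g))).
  move=> k g h; apply: star_ext => x.
  apply: etrans (comp_lfunE _ _ _) _; rewrite [RHS]star_linE star_linE.
  by rewrite /= !comp_lfunE.
have sE (g : starmod Y) x : vsval (mkhom ls g) x = vsval g (f x).
  by rewrite mkhomE /= comp_lfunE.
exists (mkhom ls) => //; apply/HomAP=> g a; apply: star_ext => x.
by rewrite star_ractE !sE star_ractE.
Qed.

(** For a transpose T of [M] with presentation P1 -> P0 -> M, and L the image of
    P0* -> P1*, there are exact sequences 0 -> L -> P1* -> T -> 0 and
    0 -> M* -> P0* -> L -> 0.  Extending evaluations along the first one, by
    Ext^1(T, A) = 0, shows that [M] is torsionless; extending maps on M* along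
    the second one, by Ext^2(T, A) = 0, shows that they are evaluations. *)
Lemma Gorenstein_projective_reflexive (M : rmodule A) :
  Gorenstein_projective M -> reflexive M.
Proof.
move=> [T [P0 [P1 [p [q [r [[[pP0 pP1 pH qH] /limgP pS qp] [rH /limgP rS rE]]]]]]] ext].
have /limg_lker[pq qpS] := qp.
have acT : Ext_acyclic T (regmod A^c) by move=> i; apply: (proj2 (ext i.+1 isT)).
have [tP0 rP0] := projective_reflexive pP0; have [_ rP1] := projective_reflexive pP1.
have sL := lkerHom_submod rH; pose k := sub_incl sL.
have kI : forall u, k u = 0 -> u = 0 := @sub_incl_eq0 _ _ _ _ sL.
have kuniq := ker0_inj kI.
have [acL ext1] := Ext_acyclic_syzygy (star_projective pP1) (sub_incl_hom sL) rH
  kI rS (limg_sub_incl sL) acT.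
have [s sH sE] := star_map qH; have [t tH tE] := star_map pH.
have [s' s'H s'E] : exists2 s', s' \in HomA (starmod P0) (subrmod sL) &
    forall g, s g = k (s' g).
  apply: sub_corestrict => // g; rewrite memv_ker; apply/eqP/rE; exists g.
  by apply/lfunP=> x; rewrite sE /precomp comp_lfunE.
have s'S u : exists g, s' g = u.
  have := sub_incl_in u; rewrite memv_ker => /eqP/rE[g gE]; exists g.
  by apply: kuniq; rewrite -s'E; apply: star_ext => x; rewrite sE gE /precomp comp_lfunE.
have tI g : t g = 0 -> g = 0.
  move=> tg; apply: star_ext => m; have [x <-] := pS m.
  by rewrite -tE tg !linear0 !zero_lfunE.
have ts : limg t = lker s'.
  apply/limg_lker; split=> [g | g sg].
    by apply: kI; rewrite -s'E; apply: star_ext => x; rewrite sE tE pq !linear0 zero_lfunE.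
  have gq x : p x = 0 -> vsval g x = 0.
    by case/qpS=> y <-; rewrite -sE s'E sg !linear0 zero_lfunE.
  have [h hH hE] := hom_factor (star_hom g) pH pS gq.
  by exists (star_elt hH); apply: star_ext => x; rewrite tE hE.
have [_ ext2] := Ext_acyclic_syzygy (star_projective pP0) tH s'H tI s'S ts acL.
split=> [m m0 | F FH].
  have [x xm] := pS m.
  have ev0 g : s' g = 0 -> eval_star x g = 0.
    have /limg_lker[_ st] := ts; case/st=> h <-.
    by rewrite eval_starE tE xm m0.
  have [G GH GE] := hom_factor (eval_star_hom x) s'H s'S ev0.
  have [H HH HE] := ext1 G GH; have [y yE] := rP1 H HH.
  suff -> : m = p (q y) by rewrite pq.
  rewrite -xm; congr (p _); apply/eqP; rewrite -subr_eq0; apply/eqP/tP0 => g.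
  by rewrite linearB /= -eval_starE GE HE -s'E yE sE subrr.
have [G GH GE] := ext2 F FH; have [x xE] := rP0 G GH.
by exists (p x) => g; rewrite GE xE tE.
Qed.

End GorensteinReflexive.

Section DominantDimension.
Variables (K : fieldType) (A : falgType K).

(** [Phi] is the property that each cosyzygy hands on to the next one. *)
Lemma min_coresolution_exists (Phi : rmodule A -> Prop) :
  (forall X, Phi X -> exists (Q : rmodule A) (j : 'Hom(X, Q)),
     [/\ is_projective Q, is_injective Q, forall x, j x = 0 -> x = 0, essential (limg j) &
         exists jH : j \in HomA X Q, Phi (quotmod (limgHom_submod jH))]) ->
  forall M, Phi M -> domdim M None.
Proof.
move=> step M PM; pose S := {X | Phi X}.
have hull (X : S) : exists c : {Q : rmodule A & 'Hom(proj1_sig X, Q)},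
    [/\ is_projective (projT1 c), is_injective (projT1 c),
       forall x, projT2 c x = 0 -> x = 0, essential (limg (projT2 c)) &
       exists jH : projT2 c \in HomA (proj1_sig X) (projT1 c),
         Phi (quotmod (limgHom_submod jH))].
  by have [Q [j jP]] := step _ (proj2_sig X); exists (existT _ Q j).
have [c cP] := choice_fun hull.
have cH X : projT2 (c X) \in HomA (proj1_sig X) (projT1 (c X)).
  by have [_ _ _ _ []] := cP X.
have cPhi X : Phi (quotmod (limgHom_submod (cH X))).
  by have [_ _ _ _ [jH]] := cP X; rewrite (bool_irrelevance jH (cH X)).
pose nxt X : S := exist _ _ (cPhi X).
pose Y n := iter n nxt (exist _ M PM : S).
pose Q n := projT1 (c (Y n)); pose j n : 'Hom(proj1_sig (Y n), Q n) := projT2 (c (Y n)).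
pose p n : 'Hom(Q n, proj1_sig (Y n.+1)) := quot_map (limgHom_submod (cH (Y n))).
have jH n : j n \in HomA (proj1_sig (Y n)) (Q n) := cH (Y n).
have jI n x : j n x = 0 -> x = 0 by have [_ _ + _ _] := cP (Y n); apply.
have pH n : p n \in HomA (Q n) (proj1_sig (Y n.+1)) := quot_map_hom _.
have pS n y : exists x, p n x = y := quot_map_onto y.
have p0 n x : p n x = 0 <-> x \in limg (j n) := quot_map_eq0 _ x.
have imd n : limg (j n.+1 \o p n)%VF = limg (j n.+1).
  apply/vspaceP=> x; apply/memv_imgP/memv_imgP=> -[y _ ->].
    by exists (p n y); rewrite ?memvf ?comp_lfunE.
  by have [z <-] := pS n y; exists z; rewrite ?memvf ?comp_lfunE.
have kerd n : lker (j n.+1 \o p n)%VF = limg (j n).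
  apply/vspaceP=> x; rewrite memv_ker comp_lfunE.
  by apply/eqP/idP=> [/jI/p0 | /p0->]; rewrite ?linear0.
have ess n : essential (limg (j n)) by have [_ _ _ + _] := cP (Y n).
have iQ n : is_injective (Q n) by have [_ + _ _ _] := cP (Y n).
have pQ n : is_projective (Q n) by have [+ _ _ _ _] := cP (Y n).
unshelve eexists (@MinInjCoresolution K A M Q (fun n => j n.+1 \o p n)%VF (j 0%N)
  iQ (fun n => HomA_comp (pH n) (jH n.+1)) (jH 0%N) _ _ _ (ess 0%N) _).
- by apply/lker0_eq0=> x; apply: jI.
- by rewrite kerd.
- by move=> n; rewrite imd kerd.
- by move=> n; rewrite imd; apply: ess.
- exact: pQ.
Qed.

Hypothesis dA : dualizing_data A.

(** The property handed on from X to a cosyzygy C = J / X is that [c] identifies X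
    with Hom_A(D(A), X) and that Ext^i(D(X), A) = 0 for all i >= 1.  The former
    embeds X in a projective-injective J; the latter, transposed, lifts maps
    D(A) -> C to J. *)
Lemma Gorenstein_domdim_infinite (M : rmodule A) :
  Gorenstein_projective M -> Ext_acyclic (dualmod M) (regmod A^c) -> domdim M None.
Proof.
have [[c canc] [J [j [pJ iJ jH jI]]]] := dA.
move=> /Gorenstein_projective_reflexive/(reflexive_conakayama canc) cM acM.
apply: (min_coresolution_exists (Phi := fun X =>
  conakayama c X /\ Ext_acyclic (dualmod X) (regmod A^c))); last by split.
move=> X [cX acX].
have [J' [pJ' iJ' [i iH iI]]] := conakayama_embeds canc pJ iJ jH jI cX.
have [Q [e [pQ iQ eH eI ess]]] := injective_hull pJ' iJ' iH iI.
exists Q, e; split=> //; exists eH.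
set sI := limgHom_submod eH; pose p := quot_map sI.
have pH : p \in HomA Q (quotmod sI) := quot_map_hom sI.
have pS y : exists x, p x = y := quot_map_onto y.
have ex : limg e = lker p.
  by apply/vspaceP=> x; rewrite memv_ker; apply/idP/eqP=> /(quot_map_eq0 sI).
have trS := proj1 (limgP _) (tr_surj (proj2 (lker0_eq0 _) eI)).
have trI := proj1 (lker0_eq0 _) (tr_inj (proj2 (limgP _) pS)).
have [acC extC] := Ext_acyclic_syzygy (dual_projective iQ) (tr_dual pH) (tr_dual eH)
  trI trS (tr_exact ex) acX.
split=> //; have cQ := reflexive_conakayama canc (projective_reflexive pQ).
apply: (conakayama_quotient canc eH pH eI ex pS) cX cQ => h hH.
have [g gH gE] := untranspose_codual hH; have [g' g'H g'E] := extC g gH.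
have [k kH kE] := untranspose_dual g'H.
exists k => // f; apply: functional_ext => u.
by rewrite -gE g'E -kE trE.
Qed.

End DominantDimension.

(** * Endomorphism algebras of generators over symmetric algebras *)

(** In this section A is End_B(N), acting through [act], and [lam] is a
    symmetrizing form on B.  Composition with [lam] is a bijection from
    Hom_B(N, B) to D(N), with inverse [base]; and [br n g] is the endomorphism
    m |-> n (base g m), that is the image of the tensor of [n] and [base g] under
    N (x)_B Hom_B(N, B) -> A.  The source of this map is D(A), by way of
    [matcoef]. *)
Section EndomorphismAlgebra.
Variables (K : fieldType) (A B : falgType K) (N : rmodule B).
Local Notation D V := 'Hom(V, K^o).
Implicit Types (g h : D N) (n m : N).
Variables (lam : D B) (act : 'Hom(A, 'End(N))).
Hypothesis lamC : forall x y, lam (x * y) = lam (y * x).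
Hypothesis lam_inj : forall x, (forall y, lam (x * y) = 0) -> x = 0.
Hypothesis lam_onto : forall l : D B, exists x, forall y, l y = lam (x * y).
Hypothesis act_inj : forall a, act a = 0 -> a = 0.
Hypothesis act_onto : forall t, t \in HomA N N -> exists a, act a = t.
Hypothesis act_hom : forall a, act a \in HomA N N.
Hypothesis act1 : act 1 = \1%VF.
Hypothesis actM : forall a b, act (a * b) = (act a \o act b)%VF.

Lemma act_ext a b : (forall n, act a n = act b n) -> a = b.
Proof.
move=> ab; apply/eqP; rewrite -subr_eq0; apply/eqP/act_inj/lfunP=> n.
by rewrite linearB add_lfunE opp_lfunE zero_lfunE /= ab subrr.
Qed.

Lemma actME a b n : act (a * b) n = act a (act b n).
Proof. by rewrite actM comp_lfunE. Qed.

Lemma act_ract a n b : act a (ract n b) = ract (act a n) b.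
Proof. exact: HomA_ract (act_hom a). Qed.

Lemma lam_uniq x x' : (forall y, lam (x * y) = lam (x' * y)) -> x = x'.
Proof.
move=> xx'; apply/eqP; rewrite -subr_eq0; apply/eqP/lam_inj => y.
by rewrite mulrBl linearB /= xx' subrr.
Qed.

Lemma to_base_exists (g : D N) : exists p : 'Hom(N, regmod B),
  forall n b, lam (p n * b) = g (ract n b).
Proof.
apply: (lfun_of_rel (R := fun n (x : B) => forall b, lam (x * b) = g (ract n b)))
  => [n | n x y xE yE | k n m x y xE yE b].
- have [x xE] := lam_onto (g \o orbit_map n)%VF.
  by exists x => b; rewrite -xE comp_lfunE orbit_mapE.
- by apply: lam_uniq => b; rewrite xE yE.
- by rewrite mulrDl -scalerAl ractDl ractZl !linearP /= xE yE.
Qed.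

Variable base : D N -> 'Hom(N, regmod B).
Hypothesis baseE : forall g n b, lam (base g n * b) = g (ract n b).

Lemma base_uniq g n x : (forall b, lam (x * b) = g (ract n b)) -> base g n = x.
Proof. by move=> xE; apply: lam_uniq => b; rewrite baseE xE. Qed.

Lemma base_ract g n b : base g (ract n b) = base g n * b :> B.
Proof. by apply: base_uniq => b'; rewrite -mulrA baseE ractM. Qed.

Lemma lam_base g n : lam (base g n) = g n.
Proof. by rewrite -[base g n]mulr1 baseE ract1. Qed.

Lemma base_act g a n : base (g \o act a)%VF n = base g (act a n).
Proof. by apply: base_uniq => b; rewrite baseE comp_lfunE act_ract. Qed.

(** Symmetry of [lam] makes [base] compatible with the other action of B, the one on
    functionals. *)
Lemma base_mul g b n : base (g \o ract_end N b)%VF n = b * base g n :> B.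
Proof.
apply: base_uniq => b'.
by rewrite -mulrA lamC -mulrA baseE comp_lfunE ract_endE -ractM.
Qed.

Lemma base_lin k g h n : base (k *: g + h) n = k *: base g n + base h n.
Proof.
apply: base_uniq => b.
by rewrite mulrDl -scalerAl linearP /= !baseE add_lfunE scale_lfunE.
Qed.

Lemma bracket_exists n g : exists a, forall m, act a m = ract n (base g m).
Proof.
have lt : linear (fun m => ract n (base g m)).
  by move=> k x y; rewrite linearP ractDr ractZr.
have [|a aE] := @act_onto (mkhom lt).
  by apply/HomAP=> m b; rewrite !mkhomE base_ract ractM.
by exists a => m; rewrite aE mkhomE.
Qed.

Variable br : N -> D N -> A.
Hypothesis brE : forall n g m, act (br n g) m = ract n (base g m).

Lemma br_linl g : linear (br^~ g).
Proof.
move=> k n m; apply: act_ext => x.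
by rewrite linearP add_lfunE scale_lfunE !brE ractDl ractZl.
Qed.

Lemma br_linr n : linear (br n).
Proof.
move=> k g h; apply: act_ext => x.
by rewrite linearP add_lfunE scale_lfunE !brE base_lin ractDr ractZr.
Qed.

Lemma mul_br a n g : a * br n g = br (act a n) g.
Proof. by apply: act_ext => m; rewrite actME !brE act_ract. Qed.

Lemma br_mul a n g : br n g * a = br n (g \o act a)%VF.
Proof. by apply: act_ext => m; rewrite actME !brE base_act. Qed.

Lemma br_bal n b g : br (ract n b) g = br n (g \o ract_end N b)%VF.
Proof. by apply: act_ext => m; rewrite !brE base_mul ractM. Qed.

Fact matcoef_is_linear n (g : D N) : linear (fun a => g (act a n) : K^o).
Proof. by move=> k a b; rewrite linearP add_lfunE scale_lfunE linearP. Qed.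

Definition matcoef n g : dualreg A := mkhom (matcoef_is_linear n g).

Lemma matcoefE n g (a : A) : (matcoef n g : D A) a = g (act a n).
Proof. exact: mkhomE. Qed.

Lemma matcoef_ract n g (a : A) : ract (matcoef n g) a = matcoef n (g \o act a)%VF.
Proof.
apply/lfunP=> x; rewrite -[LHS]/((ract (matcoef n g) a : D A) x).
rewrite dualreg_ractE !matcoefE comp_lfunE.
by rewrite actME.
Qed.

Lemma matcoef_bal n b g : matcoef (ract n b) g = matcoef n (g \o ract_end N b)%VF.
Proof.
by apply/lfunP=> a; rewrite !matcoefE act_ract comp_lfunE ract_endE.
Qed.

(** A functional on D(A) is the evaluation at some a; if it vanishes on the matrix
    coefficients of N, then a acts as zero on N. *)
Lemma matcoef_span (V : vectType K) (F G : 'Hom(dualreg A, V)) :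
  (forall n g, F (matcoef n g) = G (matcoef n g)) -> forall f, F f = G f.
Proof.
move=> FG f; apply: functional_ext => l.
have [a aE] := functional_eval (l \o (F - G))%VF.
suff a0 : a = 0.
  have := aE f; rewrite a0 linear0 comp_lfunE add_lfunE opp_lfunE linearB /=.
  by move/eqP; rewrite subr_eq0 => /eqP.
apply: act_ext => n; rewrite linear0 zero_lfunE; apply: separate_point => g.
have := aE (matcoef n g); rewrite comp_lfunE add_lfunE opp_lfunE FG subrr linear0.
by rewrite -matcoefE => <-.
Qed.

Variables (k : nat) (nb : 'I_k -> N) (gb : 'I_k -> D N).
Hypothesis genE : \sum_i base (gb i) (nb i) = 1 :> B.

(** As N is a generator, 1 is a sum of values of maps from N to B.  Hence every
    element of N, and every functional on N, is expanded along finitely many fixed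
    ones with coefficients in A; so N and D(N) are projective over A. *)
Lemma expand_elt n : n = \sum_i act (br n (gb i)) (nb i).
Proof.
by rewrite (eq_bigr _ (fun i _ => brE _ _ _)) -ract_sumr genE ract1.
Qed.

Lemma expand_functional g : g = \sum_i (gb i \o act (br (nb i) g))%VF.
Proof.
apply/lfunP=> m; rewrite sum_lfunE -[LHS]lam_base -[base g m]mul1r -genE.
rewrite mulr_suml linear_sum; apply: eq_bigr => i _.
by rewrite comp_lfunE brE /= baseE.
Qed.

(** The map sends [matcoef n g] to [br n g], and its symmetry is that of [lam].  If F
    is right linear on D(A), then F(matcoef n g) = br (t n) g for the
    endomorphism t n = sum_i F(matcoef n g_i) n_i of N over B, and t is the action
    of an element of A. *)
Lemma canonical_map_exists : exists c : 'Hom(dualreg A, regmod A), canonical_map c.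
Proof.
have [c cE] : exists c : 'Hom(dualreg A, A), forall (f : dualreg A) n g,
    g (act (c f) n) = (f : D A) (br n g).
  apply: (lfun_of_rel (R := fun (f : dualreg A) a =>
    forall n g, g (act a n) = (f : D A) (br n g)))
    => [f | f a b aE bE | l f f' a b aE bE n g].
  - have [t tE] : exists t : 'End(N), forall n g, g (t n) = (f : D A) (br n g).
      apply: (lfun_of_rel (R := fun n m => forall g, g m = (f : D A) (br n g)))
        => [n | n x y xE yE | l n m x y xE yE g].
      + have lf : linear (fun g => (f : D A) (br n g) : K^o).
          by move=> l g h; rewrite br_linr linearP.
        have [x xE] := functional_eval (mkhom lf).
        by exists x => g; rewrite -xE mkhomE.
      + by apply: functional_ext => g; rewrite xE yE.
      + by rewrite br_linl !linearP /= xE yE.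
    (* balancedness of br makes t linear over B *)
    have [|a aE] := @act_onto t.
      apply/HomAP=> n b; apply: functional_ext => g.
      by rewrite tE br_bal -tE comp_lfunE ract_endE.
    by exists a => n g; rewrite aE tE.
  - by apply: act_ext => n; apply: functional_ext => g; rewrite aE bE.
  - by rewrite linearP add_lfunE scale_lfunE linearP /= aE bE add_lfunE scale_lfunE.
have cH : (c : 'Hom(dualreg A, regmod A)) \in HomA (dualreg A) (regmod A).
  apply/HomAP=> f a; apply: act_ext => n; apply: functional_ext => g.
  by rewrite cE dualreg_ractE mul_br -cE actME.
have c_mat n g : c (matcoef n g) = br n g.
  apply: act_ext => m; apply: functional_ext => h.
  rewrite cE; apply: etrans (matcoefE _ _ _) _.
  by rewrite !brE -!baseE lamC.
exists c; split=> //.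
- move=> f h; have lh : linear (fun f : dualreg A => (h : D A) (c f) : K^o).
    by move=> l x y; rewrite !linearP.
  have le : linear (fun f : dualreg A => (f : D A) (c h) : K^o).
    by move=> l x y; rewrite add_lfunE scale_lfunE.
  have := @matcoef_span _ (mkhom le) (mkhom lh) _ f; rewrite !mkhomE => -> //.
  by move=> n g; rewrite (mkhomE le) (mkhomE lh) c_mat;
    apply: etrans (matcoefE _ _ _) (cE _ _ _).
- move=> F FH.
  have FM (f : dualreg A) (a : A) : F (ract f a) = (F f : A) * a := HomA_ract f a FH.
  have lt : linear (fun n => \sum_i act (F (matcoef n (gb i))) (nb i)).
    move=> l n m; rewrite scaler_sumr -big_split /=; apply: eq_bigr => i _.
    have -> : matcoef (l *: n + m) (gb i) = l *: matcoef n (gb i) + matcoef m (gb i).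
      by apply/lfunP=> a; rewrite add_lfunE scale_lfunE !matcoefE !linearP.
    by rewrite !linearP add_lfunE scale_lfunE.
  have Fmat n g : F (matcoef n g) = br (mkhom lt n) g.
    have -> : matcoef n g = \sum_i ract (matcoef n (gb i)) (br (nb i) g).
      apply/lfunP=> a; rewrite sum_lfunE matcoefE {1}[g]expand_functional sum_lfunE.
      by apply: eq_bigr => i _; rewrite matcoef_ract matcoefE.
    rewrite linear_sum mkhomE.
    pose bg := mkhom (br_linl g); have bgE x : br x g = bg x by rewrite mkhomE.
    rewrite bgE linear_sum; apply: eq_bigr => i _ /=.
    by rewrite -bgE -mul_br -FM.
  have [|a aE] := @act_onto (mkhom lt).
    apply/HomAP=> n b; rewrite [RHS]expand_elt {1}mkhomE; apply: eq_bigr => i _.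
    by rewrite matcoef_bal Fmat br_bal.
  exists a => f; have lc : linear (fun f : dualreg A => a * c f).
    by move=> l x y; rewrite linearP mulrDr scalerAr.
  rewrite -[RHS](mkhomE lc); apply: matcoef_span => n g.
  by rewrite Fmat (mkhomE lc) c_mat mul_br aE.
- move=> a a0; apply: act_inj; apply/lfunP=> n; rewrite zero_lfunE.
  rewrite [LHS]expand_elt big1 // => i _.
  by rewrite -mul_br -c_mat a0 linear0 zero_lfunE.
Qed.

Definition dual_bimod : rmodule A.
Proof.
refine (@RModule K A (D N) (fun g a => (g \o act a)%VF) _ _ _ _).
- by move=> a l g h; rewrite comp_lfunDl comp_lfunZl.
- by move=> g l a b; rewrite linearP comp_lfunDr comp_lfunZr.
- by move=> g; rewrite act1 comp_lfun1r.
- by move=> g a b; rewrite actM comp_lfunA.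
Defined.

Lemma dual_bimod_ractE (g : dual_bimod) (a : A) n :
  (ract g a : D N) n = (g : D N) (act a n).
Proof. by rewrite /= comp_lfunE. Qed.

Lemma dual_bimod_projective : is_projective dual_bimod.
Proof.
pose l i : 'Hom(dual_bimod, regmod A) := mkhom (br_linr (nb i)).
apply: (@dual_basis_projective _ _ dual_bimod k gb l); split=> [i | g].
  by apply/HomAP=> g a; rewrite !mkhomE /= br_mul.
by rewrite {1}[g]expand_functional; apply: eq_bigr => i _; rewrite mkhomE.
Qed.

(** The expansion of the elements of N makes D(N) a retract of a power of D(A). *)
Lemma dual_bimod_injective : is_injective dual_bimod.
Proof.
have lm i : linear (fun g : dual_bimod => matcoef (nb i) g).
  move=> l g h; apply/lfunP=> a.
  by rewrite add_lfunE scale_lfunE !matcoefE add_lfunE scale_lfunE.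
have [|m mH mE] := @pow_pair _ _ (dualreg A) k dual_bimod (fun i => mkhom (lm i)).
  by move=> i; apply/HomAP=> g a; rewrite !mkhomE matcoef_ract.
have lr1 i (f : dualreg A) : linear (fun n => (f : D A) (br n (gb i)) : K^o).
  by move=> l x y; rewrite br_linl linearP.
have lr i : linear (fun f : dualreg A => mkhom (lr1 i f)).
  move=> l f h; apply/lfunP=> n.
  by rewrite add_lfunE scale_lfunE !(mkhomE (lr1 i _)) add_lfunE scale_lfunE.
pose r i : 'Hom(dualreg A, dual_bimod) := mkhom (lr i).
have rE i f n : (r i f : D N) n = (f : D A) (br n (gb i)).
  by rewrite /r (mkhomE (lr i)) (mkhomE (lr1 i f)).
have iDA : is_injective (dualreg A).
  exact/codual_injective/dual_basis_projective/regmod_dual_basis.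
apply: (retract_injective (Q := powmod (dualreg A) k)); last exact: pow_injective.
exists m, (\sum_i (r i \o pow_proj (dualreg A) i))%VF; split=> // [|g].
  apply: rpred_sum => i _; apply: HomA_comp; first exact: pow_proj_hom.
  apply/HomAP=> f a; apply/lfunP=> n.
  by rewrite [RHS]dual_bimod_ractE !rE dualreg_ractE mul_br.
apply/lfunP=> n; rewrite !sum_lfunE [in RHS](expand_elt n) linear_sum.
by apply: eq_bigr => i _; rewrite comp_lfunE rE mE (mkhomE (lm i)) matcoefE.
Qed.

Lemma endomorphism_dualizing_data : dualizing_data A.
Proof.
split; first exact: canonical_map_exists.
pose e := vbasis {:D N}.
have oH (i : 'I_(\dim {:D N})) :
    (@orbit_map _ _ dual_bimod (e`_i) : 'Hom(regmod A, dual_bimod))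
      \in HomA (regmod A) dual_bimod.
  by apply/HomAP=> x a; rewrite !orbit_mapE; apply: (@ractM _ _ dual_bimod).
have [j jH jE] := pow_pair oH.
exists (powmod dual_bimod (\dim {:D N})), j; split=> //.
- exact/pow_projective/dual_bimod_projective.
- exact/pow_injective/dual_bimod_injective.
move=> a ja; apply: act_inj; apply/lfunP=> n; rewrite zero_lfunE.
apply: separate_point => g; rewrite (coord_vbasis (memvf g)) sum_lfunE big1 // => i _.
rewrite scale_lfunE; have := jE i a; rewrite ja linear0 orbit_mapE.
move=> /(congr1 (fun u : D N => u n)); rewrite zero_lfunE /= comp_lfunE => <-.
exact: scaler0.
Qed.

End EndomorphismAlgebra.

Lemma gendo_symmetric_dualizing_data (K : fieldType) (A : falgType K) :
  gendo_symmetric A -> dualizing_data A.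
Proof.
move=> [B [N [_ [psi psiB psiM] genN [act [act0 actI act1 actM]]]]].
pose lam : 'Hom(B, K^o) := psi 1.
have psil x y : psi x y = lam (x * y).
  by have := psiM 1 1 x y; rewrite !mul1r mulr1.
have psir x y : psi x y = lam (y * x).
  by have := psiM x 1 1 y; rewrite !mulr1 mul1r.
have [ipsi psiK ipsiK] := psiB.
have lamC x y : lam (x * y) = lam (y * x) by rewrite -psil psir.
have lam_inj x : (forall y, lam (x * y) = 0) -> x = 0.
  move=> x0; apply: (can_inj psiK); rewrite linear0; apply/lfunP=> y.
  by rewrite psil x0 zero_lfunE.
have lam_onto (l : 'Hom(B, K^o)) : exists x, forall y, l y = lam (x * y).
  by exists (ipsi l) => y; rewrite -psil ipsiK.
have act_inj a : act a = 0 -> a = 0 := proj1 (lker0_eq0 act) act0 a.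
have act_hom a : act a \in HomA N N by rewrite -actI memv_img ?memvf.
have act_onto t : t \in HomA N N -> exists a, act a = t.
  by rewrite -actI => /memv_imgP[a _ ->]; exists a.
have [base baseE] := choice_fun (to_base_exists (N := N) lam_inj lam_onto).
have [br brE] := choice_fun (fun u : N * 'Hom(N, K^o) =>
  bracket_exists lam_inj act_onto baseE u.1 u.2).
have [k [f fH /limgP fS]] := genN (regmod B).
have [x fx] := fS (1 : B).
pose gb i : 'Hom(N, K^o) := (lam \o (f \o pow_inj N i))%VF.
apply: (@endomorphism_dualizing_data K A B N lam act lamC lam_inj act_inj act_onto
  act_hom act1 actM base baseE (fun n g => br (n, g)) (fun n g => brE (n, g))
  k (fun i => pow_proj N i x) gb).
rewrite -fx [in RHS](pow_decomp x) linear_sum; apply: eq_bigr => i _ /=.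
apply: (base_uniq lam_inj baseE) => b.
rewrite !comp_lfunE (HomA_ract _ _ (pow_inj_hom N i)).
by rewrite (HomA_ract _ _ fH).
Qed.

Theorem theorem2 (K : fieldType) (A : falgType K)
    (stA : standing A) (gsA : gendo_symmetric A) (M : rmodule A) :
  Gorenstein_projective_injective M <-> domdim M None /\ codomdim M None.
Proof.
have dA := gendo_symmetric_dualizing_data gsA; have dAc := dualizing_data_op dA.
split=> [[[T trT extT] [T' trT' extT']] | [dM cM]].
  have acM : Ext_acyclic M (regmod A) by move=> i; have [] := extT i.+1 isT.
  have acDM : Ext_acyclic (dualmod M) (regmod A^c).
    by move=> i; have [] := extT' i.+1 isT.
  split; first by apply: (Gorenstein_domdim_infinite dA) acDM; exists T.
  apply: (Gorenstein_domdim_infinite dAc); first by exists T'.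
  exact: Ext_acyclic_bidual acM.
split; first exact: infinite_dimensions_Gorenstein_projective.
apply: (infinite_dimensions_Gorenstein_projective dAc) cM _.
exact: domdim_bidual dM.
Qed.
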